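(* Let $\lambda=(\lambda_1,\dots,\lambda_k)$ and $\nu=(\nu_1,\dots,\nu_k)$ be integer partitions with at most $k$ parts, and let $n=k+\lambda_1$. Then the skew Schur polynomial $s_{\lambda/\nu}(x_1,\dots,x_k)$ can be computed by a subtraction-free arithmetic circuit of size $O(n^5)$. The bit complexity of the corresponding algorithm is $O(n^5\log^2 n)$.
   Context: Subtraction-free circuits: an arithmetic circuit is an oriented network each of whose nodes (gates) performs a single arithmetic operation; its inputs are the variables and arbitrary positive integer scalars, and it outputs a rational function in the variables. It is subtraction-free if every gate is an addition, a multiplication or a division (no subtraction gates, no negative scalars). The size of a circuit is its number of gates. Bit complexity: for this purpose the input variables are viewed as numbers rather than formal variables; the bit complexity of the algorithm is the total bit cost of computing its initial values, of generating the sequence of steps to be performed, and of performing these steps, where the numbers involved are taken to have bit size logarithmic in $n$. Skew Schur polynomials: $h_m(x_1,\dots,x_k)$ denotes the complete homogeneous symmetric polynomial of degree $m$ (the sum of all monomials of degree $m$), with $h_m=0$ for $m<0$. For partitions $\lambda=(\lambda_1\ge\cdots\ge\lambda_k\ge 0)$ and $\nu=(\nu_1\ge\cdots\ge\nu_k\ge 0)$ with at most $k$ parts, $$s_{\lambda/\nu}(x_1,\dots,x_k)=\det\bigl(h_{\lambda_i-\nu_j-i+j}(x_1,\dots,x_k)\bigr)_{i,j=1}^k.$$ This polynomial is nonzero if and only if $\nu_i\le\lambda_i$ for all $i$.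
   Formalization: The formal statement assumes ν_i ≤ λ_i for all i (otherwise the skew Schur polynomial is 0, which no subtraction-free circuit with positive scalars can output), k ≥ 1, and, for the bit-complexity bound, n ≥ 2 since log 1 = 0. *)

(* Defs.v *)
From HB Require Import structures.
From mathcomp Require Import all_boot all_order all_algebra.
From mathcomp Require Import fraction.
From mathcomp Require Import mpoly.

Set Implicit Arguments.
Unset Strict Implicit.
Unset Printing Implicit Defensive.

Import GRing.Theory.

Local Open Scope ring_scope.

Definition is_partition (s : seq nat) : bool := sorted geq s.

Definition complete_sym (k d : nat) : {mpoly rat[k]} :=
  \sum_(m : 'X_{1..k < d.+1} | mdeg m == d) 'X_[m].

Definition complete_symz (k : nat) (d : int) : {mpoly rat[k]} :=
  if d is Posz e then complete_sym k e else 0.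

Definition skew_schur (k : nat) (lam nu : k.-tuple nat) : {mpoly rat[k]} :=
  \det (\matrix_(i < k, j < k)
     complete_symz k ((tnth lam i)%:Z - (tnth nu j)%:Z - i%:Z + j%:Z)).

(* A circuit is listed in a topological order of its gates, and its output is
   its last gate.  [Var i] is the i-th input variable, counted from 0, and
   [Wire j] is the output of the gate at position j of the list. *)
Inductive operand := Var of nat | Scalar of nat | Wire of nat.

Inductive gate_op := GAdd | GMul | GDiv.

Record gate := Gate { gop : gate_op; gleft : operand; gright : operand }.

Definition circuit := seq gate.

Definition wf_operand (k j : nat) (o : operand) : bool :=
  match o with
  | Var i => (i < k)%N
  | Scalar a => (0 < a)%N
  | Wire i => (i < j)%N
  end.

Fixpoint wf_from (k j : nat) (c : circuit) : bool :=
  if c is g :: c' then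
    [&& wf_operand k j (gleft g), wf_operand k j (gright g)
      & wf_from k j.+1 c']
  else true.

Definition wf_circuit (k : nat) (c : circuit) : bool :=
  (0 < size c)%N && wf_from k 0 c.

Section Evaluation.
Variables (F : fieldType) (xs : seq F).

Definition operand_value (vs : seq F) (o : operand) : F :=
  match o with
  | Var i => xs`_i
  | Scalar a => a%:R
  | Wire j => vs`_j
  end.

Definition gate_value (vs : seq F) (g : gate) : F :=
  let u := operand_value vs (gleft g) in
  let v := operand_value vs (gright g) in
  match gop g with
  | GAdd => u + v
  | GMul => u * v
  | GDiv => u / v
  end.

Definition circuit_values (c : circuit) : seq F :=
  foldl (fun vs g => rcons vs (gate_value vs g)) [::] c.

Definition circuit_output (c : circuit) : F := last 0 (circuit_values c).

End Evaluation.

Definition ratfun (k : nat) := {fraction {mpoly rat[k]}}.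

Definition formal_vars (k : nat) : seq (ratfun k) :=
  [seq tofrac ('X_i : {mpoly rat[k]}) | i <- enum 'I_k].

(* The convention x / 0 = 0 of MathComp plays no role here: all scalars being
   positive, no gate of a well-formed circuit has the value 0. *)
Definition computes (k : nat) (c : circuit) (p : {mpoly rat[k]}) : Prop :=
  wf_circuit k c /\ circuit_output (formal_vars k) c = tofrac p.

Local Open Scope nat_scope.

Definition bitlen (m : nat) : nat := (trunc_log 2 m).+1.

(* Bit cost of performing the steps of a circuit by schoolbook arithmetic, the
   inputs and the intermediate results being numbers of bit size b. *)
Definition operand_size (b : nat) (o : operand) : nat :=
  if o is Scalar a then bitlen a else b.

Definition fetch_cost (b : nat) (o : operand) : nat :=
  match o with
  | Var i => bitlen i + b
  | Scalar a => bitlen a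
  | Wire j => bitlen j + b
  end.

Definition gate_cost (b : nat) (g : gate) : nat :=
  let l := operand_size b (gleft g) in
  let r := operand_size b (gright g) in
  fetch_cost b (gleft g) + fetch_cost b (gright g) + b +
  match gop g with
  | GAdd => l + r
  | GMul | GDiv => l * r
  end.

Definition perform_cost (b : nat) (c : circuit) : nat :=
  \sum_(g <- c) gate_cost b g.

(* Programs of a random access machine with logarithmic cost.  Its memory is a
   collection of arrays of natural numbers, named by constants of the program
   and unbounded.  This memory serves for control only (indices, addresses,
   input data): the numbers on which the circuit operates are not in it, and
   the truncated subtraction of [Sub] is not a gate. *)
Inductive expr :=
  | Lit of nat
  | Read of nat & expr
  | Add of expr & expr
  | Sub of expr & expr
  | Mul of expr & expr.

Inductive operand_expr := EVar of expr | EScalar of expr | EWire of expr.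

Inductive cmd :=
  | Skip
  | Store of nat & expr & expr
  | Seq of cmd & cmd
  | If of expr & cmd & cmd
  | While of expr & cmd
  | Emit of gate_op & operand_expr & operand_expr.

Definition store := nat -> nat -> nat.

Definition upd (s : store) (r a v : nat) : store :=
  fun r' a' => if (r' == r) && (a' == a) then v else s r' a'.

Fixpoint expr_value (s : store) (e : expr) : nat :=
  match e with
  | Lit m => m
  | Read r e1 => s r (expr_value s e1)
  | Add e1 e2 => expr_value s e1 + expr_value s e2
  | Sub e1 e2 => expr_value s e1 - expr_value s e2
  | Mul e1 e2 => expr_value s e1 * expr_value s e2
  end.

Fixpoint expr_cost (s : store) (e : expr) : nat :=
  match e with
  | Lit m => bitlen m
  | Read r e1 =>
      expr_cost s e1 + bitlen (expr_value s e1) + bitlen (expr_value s e)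
  | Add e1 e2 | Sub e1 e2 =>
      expr_cost s e1 + expr_cost s e2 +
      (bitlen (expr_value s e1) + bitlen (expr_value s e2))
  | Mul e1 e2 =>
      expr_cost s e1 + expr_cost s e2 +
      bitlen (expr_value s e1) * bitlen (expr_value s e2)
  end.

Definition operand_of (s : store) (o : operand_expr) : operand :=
  match o with
  | EVar e => Var (expr_value s e)
  | EScalar e => Scalar (expr_value s e)
  | EWire e => Wire (expr_value s e)
  end.

Definition operand_expr_cost (s : store) (o : operand_expr) : nat :=
  match o with
  | EVar e | EScalar e | EWire e => expr_cost s e + bitlen (expr_value s e)
  end.

(* [exec p s s' c t]: started in the store s, the program p halts in the store
   s' after emitting the gates c, at the bit cost t. *)
Inductive exec : cmd -> store -> store -> circuit -> nat -> Prop :=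
  | ExecSkip s : exec Skip s s [::] 1
  | ExecStore s r e1 e2 :
      let a := expr_value s e1 in
      let v := expr_value s e2 in
      exec (Store r e1 e2) s (upd s r a v) [::]
        (expr_cost s e1 + expr_cost s e2 + bitlen a + bitlen v)
  | ExecSeq p1 p2 s s1 s2 c1 c2 t1 t2 :
      exec p1 s s1 c1 t1 -> exec p2 s1 s2 c2 t2 ->
      exec (Seq p1 p2) s s2 (c1 ++ c2) (t1 + t2)
  | ExecIf e p1 p2 s s' c t :
      exec (if expr_value s e != 0 then p1 else p2) s s' c t ->
      exec (If e p1 p2) s s' c (expr_cost s e + 1 + t)
  | ExecWhileStop e p s :
      expr_value s e = 0 -> exec (While e p) s s [::] (expr_cost s e + 1)
  | ExecWhileStep e p s s1 s2 c1 c2 t1 t2 :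
      expr_value s e != 0 ->
      exec p s s1 c1 t1 -> exec (While e p) s1 s2 c2 t2 ->
      exec (While e p) s s2 (c1 ++ c2) (expr_cost s e + 1 + t1 + t2)
  | ExecEmit s op o1 o2 :
      exec (Emit op o1 o2) s s
        [:: Gate op (operand_of s o1) (operand_of s o2)]
        (operand_expr_cost s o1 + operand_expr_cost s o2 + 1).

(* Array 0 initially holds k at address 0; arrays 1 and 2 hold the parts of
   lam and nu; everything else is 0. *)
Definition input_store (k : nat) (lam nu : k.-tuple nat) : store :=
  fun r a =>
    match r with
    | 0 => if a == 0 then k else 0
    | 1 => nth 0 lam a
    | 2 => nth 0 nu a
    | _ => 0
    end.

Definition generates (P : cmd) (k : nat) (lam nu : k.-tuple nat)
    (c : circuit) (t : nat) : Prop :=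
  exists s, exec P (input_store lam nu) s c t.

(* The containment of nu in lam is what makes the
   skew Schur polynomial nonzero; a subtraction-free circuit cannot output the
   zero polynomial. *)
Definition skew_shape (k : nat) (lam nu : k.-tuple nat) : Prop :=
  [/\ 0 < k, is_partition lam, is_partition nu
    & forall i : 'I_k, tnth nu i <= tnth lam i].

Definition problem_size (k : nat) (lam : k.-tuple nat) : nat := k + head 0 lam.

(* Main.v *)
Require Import Defs.
From HB Require Import structures.
From mathcomp Require Import all_boot all_order all_algebra all_fingroup.
From mathcomp Require Import fraction mpoly zify ring.

(** For a matrix M with rows 0, 1, 2, ..., let D(S) be the minor of M with
    column set S and the first |S| rows.  The Pluecker relation
      D(aTb) D(Tc) = D(aT) D(Tcb) + D(Tb) D(aTc)   (T, c between a and b)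
    computes without subtractions the D-values of all intervals of the columns
    that remain when column c is deleted, from those of the intervals before
    the deletion.  Deleting all columns outside a set J ends with D(J).

    Straight Schur polynomials.  Let M(i,c) = h_{c-i}(x_0..x_i).  Then D of the
    interval [a, a+r) is (x_0...x_{r-1})^a, and D of a set of k exponents is a
    Schur polynomial in x_0..x_{k-1}.

    Skew Schur polynomials.  Let M(i,c) = h_{c-l_i}(x_0..x_{k-1}) with
    l_i = lam_0 - lam_i + i.  The D-values of intervals are straight Schur
    polynomials by Jacobi-Trudi (lam_0, ..., lam_{r-1} minus a rectangle is a
    straight shape), and s_{lam/nu} = D(lam_0 - nu_j + j : j < k).  There are
    O(n^2) intervals, each costing O(n^3) gates.  Some D-values vanish here;
    the divisor vanishes only when the quotient does. *)

Set Implicit Arguments.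
Unset Strict Implicit.
Unset Printing Implicit Defensive.

Import Order.TTheory GRing.Theory Num.Theory.
Local Open Scope nat_scope.

(** * Step counts and logarithmic costs *)

(** The relation has no minus sign, so the obstacle is zero: no gate outputs the zero polynomial,
    while interval minors of the skew matrix do vanish. Zeros are therefore kept in the control
    memory, and the branches around them are taken when the circuit is generated. The test for zero
    is combinatorial: for columns s_0 < s_1 < ..., D(S) = 0 as soon as s_i < l_i for some i, and the
    condition l_i <= s_i for all i survives when columns move right or the last one is dropped.
    Among the minors that enter the relation, only D(aTc) may violate it while D(aTb) satisfies it,
    and that one is never a divisor.

    The skew stage goes through straight shapes because its interval minors have no product formula
    in general. In the straight matrix, giving row i only the variables x_0..x_i is what yields such
    a formula for every length r at once.

    The bit bound rests on size: every number in the control memory, wire numbers included, is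
    O(n^5), so each step of the generator costs O(log^2 n). *)

Lemma bitlen_ltP m l : (bitlen m <= l.+1) = (m < 2 ^ l.+1).
Proof.
rewrite /bitlen ltnS; apply/idP/idP => h.
  by apply: leq_trans (trunc_log_ltn m (isT : 1 < 2)) _; rewrite leq_exp2l.
case: m h => [|m] h //.
have := leq_ltn_trans (trunc_logP (isT : 1 < 2) (isT : 0 < m.+1)) h.
by rewrite ltn_exp2l.
Qed.

Lemma bitlen_gt0 m : 0 < bitlen m. Proof. by []. Qed.

Lemma ltn_bitlen m : m < 2 ^ bitlen m.
Proof. by rewrite -bitlen_ltP. Qed.

Lemma leq_bitlen m n : m <= n -> bitlen m <= bitlen n.
Proof. by move=> h; rewrite /bitlen ltnS leq_trunc_log. Qed.

Lemma bitlen_le m l : 0 < l -> m < 2 ^ l -> bitlen m <= l.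
Proof. by case: l => // l _; rewrite bitlen_ltP. Qed.

Lemma bitlenD m n : bitlen (m + n) <= bitlen m + bitlen n.
Proof.
apply: bitlen_le => //.
have hm := ltn_bitlen m; have hn := ltn_bitlen n; rewrite expnD.
have : 2 <= 2 ^ bitlen m by rewrite -[X in X <= _]expn1 leq_exp2l.
have : 2 <= 2 ^ bitlen n by rewrite -[X in X <= _]expn1 leq_exp2l.
by nia.
Qed.

Lemma bitlenM m n : bitlen (m * n) <= bitlen m + bitlen n.
Proof.
by apply: bitlen_le => //; rewrite expnD ltn_mul // ltn_bitlen.
Qed.

Lemma bitlenX m l : bitlen (m ^ l) <= l.+1 * bitlen m.
Proof.
elim: l => [|l IH]; first by rewrite expn0 mul1n (leq_trans _ (bitlen_gt0 m)).
by rewrite expnS mulSn (leq_trans (bitlenM _ _)) // leq_add2l.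
Qed.

Ltac exec_inv H := inversion H; subst; clear H;
  repeat match goal with
  | IH : forall s c t, exec ?p ?s0 s c t -> _, E : exec ?p ?s0 _ _ _ |- _ =>
      let e1 := fresh in let e2 := fresh in let e3 := fresh in
      destruct (IH _ _ _ E) as [e1 e2 e3]; subst; clear E
  end.

(** The cost bound concerns every circuit and cost that the program can generate; determinism
    reduces it to the one run that is constructed. *)
Lemma exec_det p s s1 c1 t1 : exec p s s1 c1 t1 ->
  forall s2 c2 t2, exec p s s2 c2 t2 -> [/\ s1 = s2, c1 = c2 & t1 = t2].
Proof.
elim=> {p s s1 c1 t1}.
- by move=> s s2 c2 t2 h; exec_inv h.
- by move=> s r e1 e2 a v s2 c2 t2 h; exec_inv h.
- by move=> p1 p2 s s1 s2 c1 c2 t1 t2 _ IH1 _ IH2 s3 c3 t3 h; exec_inv h.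
- by move=> e p1 p2 s s' c t _ IH s2 c2 t2 h; exec_inv h.
- by move=> e p s h0 s2 c2 t2 h; exec_inv h => //; rewrite h0 in H1.
- move=> e p s s1 s2 c1 c2 t1 t2 /eqP h0 _ IH1 _ IH2 s3 c3 t3 h; exec_inv h => //.
- by move=> s op o1 o2 s2 c2 t2 h; exec_inv h.
Qed.

(* [run B p s c s' c' m]: the program p takes the store s and the circuit c
   emitted so far to s' and c' in m steps, and stores only values of at most
   [B + size c]; the wire numbers it stores are below [size c]. *)
Inductive run (B : nat) :
    cmd -> store -> circuit -> store -> circuit -> nat -> Prop :=
  | RunSkip s c : run B Skip s c s c 1
  | RunStore s c r e1 e2 :
      expr_value s e2 <= B + size c ->
      run B (Store r e1 e2) s c
        (upd s r (expr_value s e1) (expr_value s e2)) c 1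
  | RunSeq p1 p2 s c s1 c1 s2 c2 m1 m2 :
      run B p1 s c s1 c1 m1 -> run B p2 s1 c1 s2 c2 m2 ->
      run B (Seq p1 p2) s c s2 c2 (m1 + m2)
  | RunIf e p1 p2 s c s' c' m :
      run B (if expr_value s e != 0 then p1 else p2) s c s' c' m ->
      run B (If e p1 p2) s c s' c' m.+1
  | RunWhileStop e p s c :
      expr_value s e = 0 -> run B (While e p) s c s c 1
  | RunWhileStep e p s c s1 c1 s2 c2 m1 m2 :
      expr_value s e != 0 ->
      run B p s c s1 c1 m1 -> run B (While e p) s1 c1 s2 c2 m2 ->
      run B (While e p) s c s2 c2 (m1 + m2).+1
  | RunEmit s c op o1 o2 :
      run B (Emit op o1 o2) s c s
        (rcons c (Gate op (operand_of s o1) (operand_of s o2))) 1.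

(** Emitting a gate takes a step, so the bound on circuit size comes for free from the bound on the
    number of steps. *)
Lemma run_cat B p s c s' c' m : run B p s c s' c' m ->
  exists2 d, c' = c ++ d & size d <= m.
Proof.
elim=> {p s c s' c' m}.
- by move=> s c; exists [::]; rewrite ?cats0.
- by move=> s c *; exists [::]; rewrite ?cats0.
- move=> p1 p2 s c s1 c1 s2 c2 m1 m2 _ [d1 -> h1] _ [d2 -> h2].
  by exists (d1 ++ d2); rewrite ?catA // size_cat leq_add.
- by move=> e p1 p2 s c s' c' m _ [d -> h]; exists d => //; apply: leqW.
- by move=> e p s c _; exists [::]; rewrite ?cats0.
- move=> e p s c s1 c1 s2 c2 m1 m2 _ _ [d1 -> h1] _ [d2 -> h2].
  by exists (d1 ++ d2); rewrite ?catA // size_cat leqW // leq_add.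
- move=> s c op o1 o2.
  by exists [:: Gate op (operand_of s o1) (operand_of s o2)]; rewrite ?cats1.
Qed.

Fixpoint writes (p : cmd) : seq nat :=
  match p with
  | Store r _ _ => [:: r]
  | Seq p1 p2 | If _ p1 p2 => writes p1 ++ writes p2
  | While _ p => writes p
  | _ => [::]
  end.

Lemma run_frame B p s c s' c' m : run B p s c s' c' m ->
  forall r, r \notin writes p -> s' r =1 s r.
Proof.
elim=> {p s c s' c' m} //=.
- by move=> s c r e1 e2 _ r'; rewrite inE /upd => /negbTE -> a.
- move=> p1 p2 s c s1 c1 s2 c2 m1 m2 _ IH1 _ IH2 r.
  by rewrite mem_cat negb_or => /andP[h1 h2] a; rewrite IH2 ?IH1.
- move=> e p1 p2 s c s' c' m _ IH r.
  by rewrite mem_cat negb_or => /andP[h1 h2] a; apply: IH; case: ifP.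
- by move=> e p s c s1 c1 s2 c2 m1 m2 _ _ IH1 _ IH2 r h a; rewrite IH2 ?IH1.
Qed.

Definition bounded (V : nat) (s : store) := forall r a, s r a <= V.

(** Measures bit lengths in units of [bitlen V], independently of the store. A product adds lengths,
    hence weights add even for [Mul]. *)
Fixpoint expr_weight (e : expr) : nat :=
  match e with
  | Lit m => bitlen m
  | Read _ e1 => (expr_weight e1).+1
  | Add e1 e2 | Defs.Sub e1 e2 | Mul e1 e2 => expr_weight e1 + expr_weight e2
  end.

Lemma expr_weight_gt0 e : 0 < expr_weight e.
Proof.
by elim: e => //= [e1 h1 e2 _|e1 h1 e2 _|e1 h1 e2 _]; rewrite addn_gt0 h1.
Qed.

Lemma bitlen_expr V s e : bounded V s ->
  bitlen (expr_value s e) <= expr_weight e * bitlen V.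
Proof.
move=> hV; elim: e => /= [m|r e _|e1 h1 e2 h2|e1 h1 e2 h2|e1 h1 e2 h2].
- by rewrite leq_pmulr.
- by rewrite mulSn (leq_trans (leq_bitlen (hV _ _))) // leq_addr.
- by rewrite mulnDl (leq_trans (bitlenD _ _)) // leq_add.
- rewrite mulnDl (leq_trans (leq_bitlen (leq_subr _ _))) //.
  by rewrite (leq_trans h1) // leq_addr.
- by rewrite mulnDl (leq_trans (bitlenM _ _)) // leq_add.
Qed.

(** The square comes from schoolbook multiplication. The factor 2 leaves room for the cost of the
    node itself: 2x^2 + 2y^2 + xy <= 2(x+y)^2, and x + y <= 2xy for sums since weights are
    positive. *)
Lemma expr_cost_le V s e : bounded V s ->
  expr_cost s e <= 2 * (expr_weight e * bitlen V) ^ 2.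
Proof.
move=> hV; have L0 := bitlen_gt0 V.
have w0 e' : 0 < expr_weight e' * bitlen V by rewrite muln_gt0 expr_weight_gt0.
elim: e => /= [m|r e h|e1 h1 e2 h2|e1 h1 e2 h2|e1 h1 e2 h2]; rewrite ?mulnDl.
- have := leq_pmulr (bitlen m) L0; rewrite -mulnn.
  by move: (bitlen m * _) => x; nia.
- rewrite (mulSn (expr_weight e)); move: (bitlen_expr e hV) (w0 e) h.
  move: (leq_bitlen (hV r (expr_value s e))) L0.
  move: (expr_cost s e) (bitlen (expr_value s e)) (bitlen (s r _)) => t u v.
  move: (expr_weight e * _) => x; move: (bitlen V) => L.
  rewrite -!mulnn => *; have : x <= x * L by nia.
  have : L <= L * L by nia.
  by nia.
- move: (bitlen_expr e1 hV) (bitlen_expr e2 hV) (w0 e1) (w0 e2) h1 h2.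
  by move: (expr_weight e1 * _) (expr_weight e2 * _) => x y; nia.
- move: (bitlen_expr e1 hV) (bitlen_expr e2 hV) (w0 e1) (w0 e2) h1 h2.
  by move: (expr_weight e1 * _) (expr_weight e2 * _) => x y; nia.
- move: (bitlen_expr e1 hV) (bitlen_expr e2 hV) (w0 e1) (w0 e2) h1 h2.
  by move: (expr_weight e1 * _) (expr_weight e2 * _) => x y; nia.
Qed.

Definition operand_index (o : operand) : nat :=
  match o with Var i | Scalar i | Wire i => i end.

Definition operand_weight (o : operand_expr) : nat :=
  match o with EVar e | EScalar e | EWire e => expr_weight e end.

Fixpoint cmd_weight (p : cmd) : nat :=
  match p with
  | Skip => 0
  | Store _ e1 e2 => expr_weight e1 + expr_weight e2
  | Seq p1 p2 => cmd_weight p1 + cmd_weight p2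
  | If e p1 p2 => expr_weight e + (cmd_weight p1 + cmd_weight p2)
  | While e p => expr_weight e + cmd_weight p
  | Emit _ o1 o2 => operand_weight o1 + operand_weight o2
  end.

Definition gate_fits (X : nat) (g : gate) :=
  (bitlen (operand_index (gleft g)) <= X) &&
  (bitlen (operand_index (gright g)) <= X).

(** All steps are charged at the size of the largest number ever stored. [V] and [W] are universally
    quantified so that the induction can use the size of the final circuit and the weight of the
    whole program for every piece of the run. *)
Lemma run_exec B p s c s' c' m : run B p s c s' c' m ->
  forall V W, B + size c' <= V -> bounded V s -> cmd_weight p <= W ->
  exists d t, [/\ c' = c ++ d, exec p s s' d t,
    t <= m * (4 * ((W + 1) * bitlen V) ^ 2), bounded V s' &
    all (gate_fits (W * bitlen V)) d].
Proof.
elim=> {p s c s' c' m}.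
- move=> s c V W hV hb hW; exists [::], 1; split; rewrite ?cats0 //.
    exact: ExecSkip.
  by have := bitlen_gt0 V; nia.
- move=> s c r e1 e2 he V W hV hb /= hW.
  exists [::], (expr_cost s e1 + expr_cost s e2 +
    bitlen (expr_value s e1) + bitlen (expr_value s e2)).
  split; rewrite ?cats0 //; first exact: ExecStore.
    have := expr_cost_le e1 hb; have := expr_cost_le e2 hb.
    have := bitlen_expr e1 hb; have := bitlen_expr e2 hb.
    have := bitlen_gt0 V.
    have : (expr_weight e1 + expr_weight e2) * bitlen V <= W * bitlen V.
      by rewrite leq_mul2r hW orbT.
    rewrite mul1n !mulnDl mul1n.
    move: (expr_weight e1 * _) (expr_weight e2 * _) (W * _) => x y z; nia.
  by move=> r' a; rewrite /upd; case: ifP => // _; apply: leq_trans hV.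
- move=> p1 p2 s c s1 c1 s2 c2 m1 m2 r1 IH1 r2 IH2 V W hV hb /= hW.
  have [d2 e2 _] := run_cat r2.
  have hV1 : B + size c1 <= V by move: hV; rewrite e2 size_cat; lia.
  have [d1 [t1 [? E1 T1 hb1 f1]]] := IH1 V W hV1 hb (ltac:(lia)).
  have [d3 [t2 [? E2 T2 hb2 f2]]] := IH2 V W hV hb1 (ltac:(lia)).
  exists (d1 ++ d3), (t1 + t2); subst; split; rewrite ?catA //.
  + exact: ExecSeq E1 E2.
  + by rewrite mulnDl leq_add.
  + by rewrite all_cat f1.
- move=> e p1 p2 s c s' c' m _ IH V W hV hb /= hW.
  have hW' : cmd_weight (if expr_value s e != 0 then p1 else p2) <= W.
    by case: ifP; lia.
  have [d [t [? E T hb1 f]]] := IH V W hV hb hW'.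
  exists d, (expr_cost s e + 1 + t); split => //; first exact: ExecIf E.
  have := expr_cost_le e hb; have := bitlen_gt0 V.
  have : expr_weight e * bitlen V <= W * bitlen V.
    by rewrite leq_mul2r; apply/orP; right; lia.
  move: T; rewrite (mulSn m) !mulnDl mul1n; move: (m * _) => M.
  move: (expr_weight e * _) (W * _) => x z; nia.
- move=> e p s c h0 V W hV hb /= hW.
  exists [::], (expr_cost s e + 1); split; rewrite ?cats0 //.
    exact: ExecWhileStop.
  have := expr_cost_le e hb; have := bitlen_gt0 V.
  have : expr_weight e * bitlen V <= W * bitlen V.
    by rewrite leq_mul2r; apply/orP; right; lia.
  rewrite !mulnDl !mul1n.
  move: (expr_weight e * _) (W * _) => x z; nia.
- move=> e p s c s1 c1 s2 c2 m1 m2 h0 r1 IH1 r2 IH2 V W hV hb /= hW.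
  have [d2 e2 _] := run_cat r2.
  have hV1 : B + size c1 <= V by move: hV; rewrite e2 size_cat; lia.
  have [d1 [t1 [? E1 T1 hb1 f1]]] := IH1 V W hV1 hb (ltac:(lia)).
  have [d3 [t2 [? E2 T2 hb2 f2]]] := IH2 V W hV hb1 hW.
  exists (d1 ++ d3), (expr_cost s e + 1 + t1 + t2); subst.
  split; rewrite ?catA //.
  + exact: ExecWhileStep h0 E1 E2.
  + have := expr_cost_le e hb; have := bitlen_gt0 V.
    have : expr_weight e * bitlen V <= W * bitlen V.
      by rewrite leq_mul2r; apply/orP; right; lia.
    move: T1 T2; rewrite (mulSn (m1 + m2)) (mulnDl m1) !mulnDl mul1n.
    move: (m1 * _) (m2 * _) => M1 M2.
    move: (expr_weight e * _) (W * _) => x z; nia.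
  + by rewrite all_cat f1.
- move=> s c op o1 o2 V W hV hb /= hW.
  have ho o : operand_expr_cost s o <=
      2 * (operand_weight o * bitlen V) ^ 2 + operand_weight o * bitlen V.
    by case: o => e /=; rewrite leq_add ?expr_cost_le ?bitlen_expr.
  have hi o : bitlen (operand_index (operand_of s o)) <=
      operand_weight o * bitlen V.
    by case: o => e /=; rewrite bitlen_expr.
  exists [:: Gate op (operand_of s o1) (operand_of s o2)],
    (operand_expr_cost s o1 + operand_expr_cost s o2 + 1).
  have hW' :
      (operand_weight o1 + operand_weight o2) * bitlen V <= W * bitlen V.
    by rewrite leq_mul2r hW orbT.
  split=> //; rewrite ?cats1 //; first exact: ExecEmit.
    have := ho o1; have := ho o2; have := bitlen_gt0 V; move: hW'.
    rewrite !mulnDl !mul1n.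
    move: (operand_weight o1 * _) (operand_weight o2 * _) (W * _) => x y z; nia.
  rewrite /= andbT /gate_fits /=; move: (hi o1) (hi o2) hW'.
  by rewrite !mulnDl; lia.
Qed.

(** The 5 counts two fetches, the result and two operand sizes, each at most X + b; a product of
    sizes is at most (X + b)^2. *)
Lemma perform_cost_le b X c : 0 < X -> all (gate_fits X) c ->
  perform_cost b c <= size c * (5 * (X + b) ^ 2).
Proof.
move=> X0; rewrite /perform_cost; elim: c => [|g c IH] /=; first by rewrite big_nil.
case/andP=> /andP[h1 h2] /IH {}IH; rewrite big_cons mulSn leq_add //.
have hf o : bitlen (operand_index o) <= X ->
    fetch_cost b o <= X + b /\ operand_size b o <= X + b.
  by case: o => i /=; lia.
have [f1 s1] := hf _ h1; have [f2 s2] := hf _ h2; rewrite /gate_cost.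
move: (fetch_cost _ _) (fetch_cost _ _) (operand_size _ _) (operand_size _ _) f1 f2 s1 s2.
by move=> x y z w; case: (gop g); nia.
Qed.

(** * Flag minors *)

Section Minors.
Local Open Scope ring_scope.
Variables (R : comNzRingType) (M : nat -> nat -> R).

Definition flag_minor (cs : seq nat) : R :=
  \det (\matrix_(i < size cs, j < size cs) M i (nth 0%N cs j)).

Lemma flag_minorE n cs : size cs = n ->
  flag_minor cs = \det (\matrix_(i < n, j < n) M i (nth 0%N cs j)).
Proof. by rewrite /flag_minor => ->. Qed.

Lemma flag_minor_swap S1 x y S2 :
  flag_minor (S1 ++ x :: y :: S2) = - flag_minor (S1 ++ y :: x :: S2).
Proof.
set n := (size S1 + (size S2).+2)%N.
rewrite !(@flag_minorE n) ?size_cat //.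
have i1 : (size S1 < n)%N by rewrite /n; lia.
have i2 : ((size S1).+1 < n)%N by rewrite /n; lia.
set A := (X in _ = - \det X).
have -> : \matrix_(i < n, j < n) M i (nth 0%N (S1 ++ x :: y :: S2) j)
        = col_perm (tperm (Ordinal i1) (Ordinal i2)) A.
  apply/matrixP => i j; rewrite !mxE !nth_cat; congr (M _ _).
  case: tpermP => [->|->|/eqP h1 /eqP h2] /=.
  - by rewrite ltnn subnn ltnNge leqnSn /= subSnn.
  - by rewrite ltnn subnn ltnNge leqnSn /= subSnn.
  - case: ltnP => // h; have : (j - size S1 != 0)%N && (j - size S1 != 1)%N.
      by move: h1 h2; rewrite -!val_eqE /=; lia.
    by case: (j - size S1)%N => [|[|z]].
rewrite col_permE det_mulmx det_perm tpermV odd_tperm.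
have -> : Ordinal i1 != Ordinal i2 by rewrite -val_eqE /=; lia.
by rewrite expr1 mulrN1.
Qed.

Lemma flag_minor_rot S1 x S2 :
  flag_minor (S1 ++ x :: S2) = (-1) ^+ size S1 * flag_minor (x :: S1 ++ S2).
Proof.
elim/last_ind: S1 S2 => [|S1 y IH] S2; first by rewrite mul1r.
rewrite !cat_rcons flag_minor_swap IH size_rcons exprS.
by rewrite mulN1r mulNr.
Qed.

Lemma flag_minor_linear S : exists K : nat -> R, forall v,
  flag_minor (v :: S) = \sum_(i < (size S).+1) K i * M i v.
Proof.
set n := size S.
pose A v := \matrix_(i < n.+1, j < n.+1) M i (nth 0%N (v :: S) j).
exists (fun i => cofactor (A 0%N) (inord i) ord0) => v.
rewrite (@flag_minorE n.+1) // (expand_det_col _ ord0); apply: eq_bigr => i _.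
rewrite mxE /= mulrC inord_val; congr (_ * _); rewrite /cofactor; congr (_ * \det _).
by apply/matrixP => i' j'; rewrite !mxE.
Qed.

Lemma flag_minor_mem v S : v \in S -> flag_minor (v :: S) = 0.
Proof.
move=> /(nthP 0%N)[j hj <-]; rewrite (@flag_minorE (size S).+1) //.
rewrite -det_tr.
apply: (determinant_alternate (i1 := ord0) (i2 := lift ord0 (Ordinal hj))) => //.
by move=> i; rewrite !mxE.
Qed.

(* The vanishing determinant whose first row lists the size-(s+1) minors
   bordering S: that row is a combination of the other ones. *)
Lemma pluecker_cyclic a b c S :
  flag_minor (b :: c :: S) * flag_minor (a :: S)
  + flag_minor (a :: b :: S) * flag_minor (c :: S)
  = flag_minor (a :: c :: S) * flag_minor (b :: S).
Proof.
have [K hK] := flag_minor_linear S.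
set s := size S; pose g := [:: a, b, c & S].
(* Row 0 is left free; the rows below it are the first s+2 rows of [M] on the columns a, b, c, S. *)
pose N (u : nat -> R) := \matrix_(i < s.+3, j < s.+3)
  if nat_of_ord i is i'.+1 then M i' (nth 0%N g j) else u j.
pose C (j : 'I_s.+3) := cofactor (N (fun=> 0)) ord0 j.
have detN u : \det (N u) = \sum_(j < s.+3) u j * C j.
  rewrite (expand_det_row _ ord0); apply: eq_bigr => j _; rewrite mxE /=.
  congr (_ * _); rewrite /C /cofactor; congr (_ * \det _).
  by apply/matrixP => i' j'; rewrite !mxE.
(* Putting row i of [M] in place of row 0 repeats a row. *)
have row0 i : (i < s.+1)%N -> \sum_(j < s.+3) M i (nth 0%N g j) * C j = 0.
  move=> hi; rewrite -(detN (fun j => M i (nth 0%N g j))).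
  have hi2 : (i < s.+2)%N by lia.
  apply: (determinant_alternate (i1 := ord0) (i2 := lift ord0 (Ordinal hi2))) => //.
  by move=> j; rewrite !mxE.
have : \sum_(j < s.+3) flag_minor (nth 0%N g j :: S) * C j = 0.
  under eq_bigr => j _ do rewrite hK mulr_suml.
  rewrite exchange_big big1 // => i _.
  by under eq_bigr => j _ do rewrite -mulrA; rewrite -mulr_sumr row0 ?mulr0.
have CE (j : 'I_s.+3) : C j = (-1) ^+ j *
   flag_minor (take j g ++ drop j.+1 g).
  have hs : size (take j g ++ drop j.+1 g) = s.+2.
    by rewrite size_cat size_take size_drop /= -/s; case: j => j /= hj; case: ifP; lia.
  rewrite /C /cofactor add0n (flag_minorE hs); congr (_ * \det _).
  apply/matrixP => i' j'; rewrite !mxE /=; congr (M _ _).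
  have hj := ltn_ord j.
  rewrite nth_cat size_take_min /= -/s (minn_idPl (ltnW hj)) /bump.
  case: ltnP => h.
    by rewrite nth_take //= leqNgt h.
  by rewrite nth_drop subnKC.
(* Bordering S by one of its own columns gives 0, so only the terms of a, b and c remain. *)
rewrite !big_ord_recl big1 => [|j _]; last first.
  by rewrite flag_minor_mem ?mul0r //= mem_nth // /bump /=; have := ltn_ord j; lia.
rewrite !CE /= /bump /= !drop0 addr0 expr0 expr1 mul1r => /eqP.
rewrite -subr_eq0 => /eqP h; apply/eqP; rewrite -subr_eq0; apply/eqP.
by rewrite -h; ring.
Qed.

(** This is [pluecker_cyclic] with b and c exchanged and the columns sorted. Sorting multiplies each
    of the three products by the same sign [u * v], so the relation stays free of minus signs. *)
Lemma pluecker a S1 c S2 b :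
  flag_minor (a :: S1 ++ S2 ++ [:: b]) * flag_minor (S1 ++ c :: S2) =
  flag_minor (a :: S1 ++ S2) * flag_minor (S1 ++ c :: S2 ++ [:: b])
  + flag_minor (S1 ++ S2 ++ [:: b]) * flag_minor (a :: S1 ++ c :: S2).
Proof.
have h := pluecker_cyclic a c b (S1 ++ S2).
have e1 : flag_minor (a :: S1 ++ S2 ++ [:: b]) =
    (-1) ^+ size (S1 ++ S2) * flag_minor [:: a, b & S1 ++ S2].
  rewrite -[a :: _]/((a :: S1) ++ S2 ++ [:: b]) catA flag_minor_rot cats0 /=.
  by rewrite (@flag_minor_swap [::]) /= exprS; ring.
have e3 : flag_minor (S1 ++ c :: S2 ++ [:: b]) =
    (-1) ^+ size S1 * (-1) ^+ size (S1 ++ S2) * flag_minor [:: c, b & S1 ++ S2].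
  rewrite flag_minor_rot -[c :: _]/((c :: S1) ++ S2 ++ [:: b]) catA.
  by rewrite flag_minor_rot cats0 /= (@flag_minor_swap [::]) /= exprS; ring.
have e5 : flag_minor (a :: S1 ++ c :: S2) =
    (-1) ^+ size S1 * flag_minor [:: a, c & S1 ++ S2].
  rewrite -[a :: _]/((a :: S1) ++ c :: S2) flag_minor_rot /=.
  by rewrite (@flag_minor_swap [::]) /= exprS; ring.
rewrite (flag_minor_rot S1) e1 e3 e5 [S1 ++ S2 ++ _]catA flag_minor_rot cats0.
move: h; move: (_ ^+ size (S1 ++ S2)) (_ ^+ size S1) => u v h.
transitivity (u * v * (flag_minor [:: a, b & S1 ++ S2] * flag_minor (c :: S1 ++ S2))).
  by ring.
by rewrite -h; ring.
Qed.

End Minors.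

(** * Block and reversal identities for determinants *)

Section Determinants.
Local Open Scope ring_scope.
Variable R : comNzRingType.
Implicit Type F : nat -> nat -> R.

Lemma det_unitriangular_corner m r F :
    (forall j, (j < m)%N -> F j j = 1) ->
    (forall i j, (j < m)%N -> (j < i)%N -> F i j = 0) ->
  \det (\matrix_(i < m + r, j < m + r) F i j)
  = \det (\matrix_(i < r, j < r) F (m + i)%N (m + j)%N).
Proof.
elim: m F => [|m IH] F h1 h0 //.
rewrite (expand_det_col _ ord0) big_ord_recl big1 => [|i _]; last first.
  by rewrite mxE h0 ?mul0r.
rewrite mxE h1 // mul1r addr0 /cofactor expr0 mul1r.
rewrite -(IH (fun i j => F i.+1 j.+1)) => [|j hj|i j hj hij].
- by congr (\det _); apply/matrixP => i j; rewrite !mxE.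
- exact: h1.
- exact: h0.
Qed.

Lemma det_reverse n F :
  \det (\matrix_(i < n, j < n) F (n.-1 - i)%N (n.-1 - j)%N)
  = \det (\matrix_(i < n, j < n) F i j).
Proof.
set A := \matrix_(i < n, j < n) F i j; pose s := perm (@rev_ord_inj n).
have -> : \matrix_(i < n, j < n) F (n.-1 - i)%N (n.-1 - j)%N
    = row_perm s (col_perm s A).
  apply/matrixP => i j; rewrite !mxE !permE /=.
  by congr (F _ _); [have := ltn_ord i | have := ltn_ord j]; lia.
rewrite row_permE col_permE !det_mulmx !det_perm odd_permV.
by rewrite mulrC -mulrA -signr_addb addbb mulr1.
Qed.

(** The n - p rows from p on have their nonzero entries in only n - p - 1 columns, so every
    permutation meets the zero block. *)
Lemma det_zero_corner n p F : (p < n)%N ->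
    (forall i j, (p <= i < n)%N -> (j <= p)%N -> F i j = 0) ->
  \det (\matrix_(i < n, j < n) F i j) = 0.
Proof.
move=> hp h; rewrite /determinant big1 // => s _.
have [i /andP[h1 h2]] : exists i : 'I_n, (p <= i)%N && (s i <= p)%N.
  apply/existsP; apply: contraT; rewrite negb_exists => /forallP hs.
  pose A := [set i : 'I_n | (p <= i)%N]; pose B := [set i : 'I_n | (p < i)%N].
  have sAB : s @: A \subset B.
    apply/subsetP => _ /imsetP[i hi ->]; move: (hs i) hi; rewrite !inE.
    by move=> hsi hi; rewrite hi /= -ltnNge in hsi.
  have hA : A = Ordinal hp |: B.
    by apply/setP => i; rewrite !inE -val_eqE /= leq_eqVlt eq_sym.
  move: (subset_leq_card sAB); rewrite card_imset; last exact: perm_inj.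
  by rewrite hA cardsU1 inE ltnn /= add1n ltnn.
by rewrite (bigD1 i) //= mxE h ?mul0r ?mulr0 // h1 ltn_ord.
Qed.

End Determinants.

(** * Complete homogeneous polynomials and the minors of the two matrices *)

Section CompleteHomogeneous.
Local Open Scope ring_scope.
Variables (R : comNzRingType) (x : nat -> R).

(** The recursion on the last variable replaces the sum over monomials; [complete_sym_hsym]
    identifies the two. *)
Fixpoint hsym (m : nat) : nat -> R :=
  if m is m'.+1 then
    fix hsym_m d := if d is d'.+1 then hsym m' d + x m' * hsym_m d' else 1
  else fun d => (d == 0)%:R.

Definition hsymz (m : nat) (z : int) : R := if z is Posz d then hsym m d else 0.

Lemma hsym0 m : hsym m 0 = 1.
Proof. by case: m. Qed.

Lemma hsymz_rec m z : hsymz m.+1 z = hsymz m z + x m * hsymz m.+1 (z - 1).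
Proof.
case: z => [[|d]|d]; last by rewrite /= mulr0 addr0.
  by rewrite /= hsym0 mulr0 addr0.
by have -> : (d.+1%:Z - 1 = d)%R by lia.
Qed.

Lemma hsymz0 m : hsymz m 0 = 1.
Proof. exact: hsym0. Qed.

Lemma hsymz_neg m z : (z < 0)%R -> hsymz m z = 0.
Proof. by case: z. Qed.

(** By the generating function, removing the e variables x_m, ..., x_{m+e-1} multiplies by the
    product of the 1 - x_i t; thus u_l is (-1)^l times their elementary symmetric polynomial of
    degree l. *)
Lemma hsymz_more_vars m e : exists u : nat -> R,
  [/\ u 0%N = 1, forall l, (e < l)%N -> u l = 0 &
   forall z, hsymz m z = \sum_(l < e.+1) u l * hsymz (m + e) (z - l%:Z)].
Proof.
elim: e m => [|e IH] m.
  exists (fun l => (l == 0)%:R); split=> [|[]|z] //.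
  by rewrite big_ord1 mul1r addn0 subr0.
have [u [u0 ue hu]] := IH m.+1.
exists (fun l => u l - (if l is l'.+1 then x m * u l' else 0)); split.
- by rewrite u0 subr0.
- by case=> // l hl; rewrite !ue ?mulr0 ?subr0 // ltnW.
move=> z; have -> : hsymz m z = hsymz m.+1 z - x m * hsymz m.+1 (z - 1).
  by rewrite (hsymz_rec m z) addrK.
rewrite !hu addSn -addnS.
under [RHS]eq_bigr => l _ do rewrite mulrBl.
rewrite sumrB; congr (_ - _).
  by rewrite [RHS]big_ord_recr /= ue // mul0r addr0.
rewrite [RHS]big_ord_recl /= mul0r add0r mulr_sumr; apply: eq_bigr => l _.
by rewrite mulrA /bump /=; congr (_ * _ * hsymz _ _); lia.
Qed.

(* The size-r flag minors of this matrix involve only the first r variables: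
   they are Schur polynomials of shapes with r parts, and never vanish. *)
Definition flagged_h (i c : nat) : R := hsymz i.+1 (c%:Z - i%:Z).

(** A row operation: the k-1-i variables that row i lacks match the k-1-i rows below it. By
    [hsymz_more_vars], row i is therefore a combination of the rows i, ..., k-1 of the matrix in all
    k variables, with coefficient 1 on row i. *)
Lemma flag_minor_flagged_h k cs : size cs = k ->
  flag_minor flagged_h cs
  = \det (\matrix_(i < k, j < k) hsymz k ((nth 0%N cs j)%:Z - i%:Z)).
Proof.
move=> hk; rewrite (flag_minorE _ hk).
have /fin_all_exists [u hu] (i : 'I_k) := hsymz_more_vars i.+1 (k - i.+1).
pose U := \matrix_(i < k, i' < k) if (i <= i')%N then u i (i' - i)%N else 0.
have detU : \det U = 1.
  rewrite -det_tr det_trig; last first.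
    by apply/is_trig_mxP => i j hij; rewrite !mxE leqNgt hij.
  by apply: big1 => i _; rewrite !mxE leqnn subnn; case: (hu i).
rewrite -[RHS]mul1r -detU -det_mulmx; congr (\det _); apply/matrixP => i j.
have [_ _ hui] := hu i; rewrite !mxE /flagged_h hui.
under [RHS]eq_bigr => i' _ do rewrite !mxE.
rewrite subnKC //; set c := nth _ _ _.
have -> : (k - i.+1).+1 = (k - i)%N by have := ltn_ord i; lia.
transitivity (\sum_(j < i + (k - i)) (if (i <= j)%N then
    u i (j - i)%N * hsymz k (c%:Z - i%:Z - (j - i)%N%:Z) else 0)).
  rewrite big_split_ord big1 => [|l _] /=; last by rewrite leqNgt ltn_ord.
  by rewrite add0r; apply: eq_bigr => l _; rewrite leq_addr addKn.
rewrite subnKC; last exact: ltnW.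
apply: eq_bigr => i' _; rewrite ?mxE; case: leqP => hij; last by rewrite mul0r.
by congr (_ * hsymz _ _); lia.
Qed.

Lemma flag_minor_flagged_h_iota a r :
  flag_minor flagged_h (iota a r) = (\prod_(i < r) x i) ^+ a.
Proof.
have E b : flag_minor flagged_h (iota b r)
    = \det (\matrix_(i < r, j < r) flagged_h i (b + j)).
  rewrite (@flag_minorE _ _ r) ?size_iota //; congr (\det _).
  by apply/matrixP => i j; rewrite !mxE nth_iota.
elim: a => [|a IH].
  rewrite E expr0 -[r in LHS]addn0.
  rewrite (@det_unitriangular_corner _ r 0 (fun i j => flagged_h i (0 + j))).
  - by rewrite det_mx00.
  - by move=> j _; rewrite /flagged_h add0n subrr hsymz0.
  - by move=> i j _ hij; rewrite /flagged_h hsymz_neg // add0n; lia.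
(* By the recursion on the last variable, row i of the interval at a+1 is x_i times row i of the
   interval at a plus its row i-1. So [B] is lower bidiagonal, and each shift multiplies the minor
   by its determinant. *)
pose B := \matrix_(i < r, j < r) (x i *+ (i == j) + (i == j.+1 :> nat)%:R).
have detB : \det B = \prod_(i < r) x i.
  rewrite det_trig; last first.
    apply/is_trig_mxP => i j hij; rewrite !mxE -val_eqE.
    by rewrite !(ltn_eqF _) ?mulr0n ?addr0 // ltnW.
  by apply: eq_bigr => i _; rewrite !mxE eqxx ltn_eqF // addr0.
rewrite exprSr -IH -detB mulrC !E -det_mulmx; congr (\det _).
apply/matrixP => i j; rewrite !mxE /flagged_h hsymz_rec addrC.
under eq_bigr => l _ do rewrite !mxE mulrDl.
rewrite big_split /=; congr (_ + _).
  rewrite (bigD1 i) //= big1 => [|l hl]; last by rewrite eq_sym (negbTE hl) mulr0n mul0r.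
  by rewrite eqxx mulr1n addr0; congr (_ * hsymz _ _); lia.
case: i => [[|i] hi] /=.
  by rewrite big1 // => l _; rewrite mul0r.
rewrite (bigD1 (Ordinal (ltnW hi))) //= eqxx mul1r big1 => [|l hl]; last first.
  by rewrite -val_eqE /= in hl; rewrite eqSS eq_sym (negbTE hl) mul0r.
by rewrite addr0; congr (hsymz _ _); lia.
Qed.

Definition skew_h (k : nat) (l : nat -> nat) (i c : nat) : R :=
  hsymz k (c%:Z - (l i)%:Z).

(* Jacobi-Trudi: the left side is a straight Schur determinant of size r, which
   the exponents 0, ..., k-r-1 on the right border by a unitriangular block. *)
Lemma flag_minor_skew_h_iota k l a r : (r <= k)%N ->
    (forall q, (q < r)%N -> (l q <= k.-1 + a)%N) ->
  flag_minor (skew_h k l) (iota a r) =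
  flag_minor flagged_h
    (iota 0 (k - r) ++ mkseq (fun q => k.-1 + a - l (r.-1 - q))%N r).
Proof.
move=> hr hl; set cs := _ ++ _.
have hs : size cs = k by rewrite size_cat size_iota size_mkseq subnK.
rewrite (flag_minor_flagged_h hs) (@flag_minorE _ _ r) ?size_iota //.
rewrite -[k in RHS](subnK hr).
rewrite (@det_unitriangular_corner _ (k - r) r
  (fun i j => hsymz (k - r + r) ((nth 0%N cs j)%:Z - i%:Z))).
(* Rows of one matrix are columns of the other, and reversing both orders keeps the determinant. *)
- rewrite subnK // -det_tr -(det_reverse _
    (fun i j => hsymz k ((nth 0%N cs (k - r + j))%:Z - (k - r + i)%:Z))).
  congr (\det _); apply/matrixP => i j.
  have hi := ltn_ord i; have hj := ltn_ord j.
  rewrite !mxE nth_iota // /skew_h nth_cat size_iota ltnNge leq_addr /= addKn.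
  rewrite nth_mkseq; last by lia.
  have -> : (r.-1 - (r.-1 - j) = j)%N by lia.
  by have hlj := hl _ hj; congr (hsymz _ _); lia.
- by move=> j hj; rewrite nth_cat size_iota hj nth_iota // subrr hsymz0.
- move=> i j hj hij; rewrite nth_cat size_iota hj nth_iota // hsymz_neg //; lia.
Qed.

(** A negative degree on the diagonal spreads, by monotonicity of [l] and [cs], to all entries below
    and to the left of it. *)
Lemma flag_minor_skew_h_eq0 k l cs p : (p < size cs)%N ->
    {homo l : i j / (i <= j)%N} -> sorted leq cs -> (nth 0%N cs p < l p)%N ->
  flag_minor (skew_h k l) cs = 0.
Proof.
move=> hp hl hcs h.
apply: (@det_zero_corner _ _ p (fun i j => skew_h k l i (nth 0%N cs j))) => //.
move=> i j /andP[hpi hi] hjp.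
have h1 := hl _ _ hpi.
have h2 : (nth 0 cs j <= nth 0 cs p)%N.
  by apply: (sorted_leq_nth leq_trans leqnn) => //; rewrite inE // (leq_ltn_trans hjp).
by rewrite /skew_h hsymz_neg //; lia.
Qed.

End CompleteHomogeneous.

(** * Skew Schur polynomials as flag minors *)

Section SkewSchur.
Local Open Scope ring_scope.
Variable k : nat.

Definition mvar (i : nat) : {mpoly rat[k]} :=
  nth 0 [seq 'X_j : {mpoly rat[k]} | j <- enum 'I_k] i.

Lemma mvarE (i : 'I_k) : mvar i = 'X_i.
Proof. by rewrite /mvar (nth_map i) ?size_enum_ord // nth_ord_enum. Qed.

Lemma mcoeffXM_eq0 (i : 'I_k) (p : {mpoly rat[k]}) (m : 'X_{1..k}) :
  m i = 0%N -> ('X_i * p)@_m = 0.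
Proof.
move=> hm; apply/eqP; rewrite mcoeff_eq0 mulrC (perm_mem (msuppMX _ _)).
by apply/mapP => -[m' _ /mnmP/(_ i)]; rewrite hm mnmDE mnm1E eqxx.
Qed.

(** Exactly one term of the recursion can contribute to a given monomial: the first if the newest
    variable is absent from it, the second if it divides it. *)
Lemma mcoeff_hsym m d (mu : 'X_{1..k}) : (m <= k)%N ->
  (hsym mvar m d)@_mu
  = ((mdeg mu == d) && [forall i : 'I_k, (m <= i)%N ==> (mu i == 0)%N])%:R.
Proof.
have all0 (nu : 'X_{1..k}) (c : pred 'I_k) :
    mdeg nu = 0%N -> [forall i, c i ==> (nu i == 0)%N].
  by move/eqP; rewrite mdeg_eq0 => /eqP ->; apply/forallP => i; rewrite mnmE eqxx implybT.
elim: m d mu => [|m IHm] d mu hm.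
  rewrite /=; case: d => [|d].
    rewrite mcoeff1 -mdeg_eq0; case: eqP => //= h.
    by rewrite (all0 _ (fun=> true)).
  rewrite mcoeff0; case: eqP => //= h; case: forallP => // h0.
  have : mdeg mu = 0%N by rewrite mdegE big1 // => i _; apply/eqP/h0.
  by rewrite h.
elim: d mu => [|d IHd] mu.
  rewrite /= mcoeff1 -mdeg_eq0; case: eqP => //= h.
  by rewrite (all0 _ (fun i => m < i)%N).
rewrite -[hsym _ _ _]/(hsym mvar m d.+1 + mvar m * hsym mvar m.+1 d).
pose i0 := Ordinal hm; rewrite mcoeffD IHm //; last exact: ltnW.
rewrite (mvarE i0); case: (posnP (mu i0)) => h0.
  rewrite (mcoeffXM_eq0 _ h0) addr0; congr (_ && _)%:R.
  apply/forallP/forallP => h i; move: (h i); first by case: (ltngtP m i).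
  case: (ltngtP m i) => //= e _; have -> : i = i0 by apply: val_inj.
  exact/eqP.
have -> : [forall i : 'I_k, (m <= i)%N ==> (mu i == 0)%N] = false.
  by apply/forallP => /(_ i0) /=; rewrite leqnn eqn0Ngt h0.
rewrite andbF add0r.
have e : mu = (mu - U_(i0) + U_(i0))%MM.
  by rewrite submK //; apply/mnm_lepP => i; rewrite mnm1E; case: eqP => // <-.
rewrite mulrC [in LHS]e addmC mcoeffMX IHd.
congr (_ && _)%:R; first by rewrite [in RHS]e mdegD mdeg1 addn1 eqSS.
apply: eq_forallb => i; rewrite mnmBE mnm1E; case: (i0 =P i) => [<-|_]; last first.
  by rewrite subn0.
by rewrite /= ltnn.
Qed.

Lemma complete_sym_hsym d : complete_sym k d = hsym mvar k d.
Proof.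
apply/mpolyP => mu; rewrite mcoeff_hsym // /complete_sym raddf_sum /=.
have -> : [forall i : 'I_k, (k <= i)%N ==> (mu i == 0)%N].
  by apply/forallP => i; rewrite leqNgt ltn_ord.
rewrite andbT; under eq_bigr => m _ do rewrite mcoeffX.
case: eqP => hd.
  have hlt : (mdeg mu < d.+1)%N by rewrite hd.
  rewrite (bigD1 (BMultinom hlt)) /= ?hd // eqxx big1 ?addr0 // => m /andP[_ h].
  by case: eqP => // e; rewrite -val_eqE /= e eqxx in h.
by rewrite big1 // => m /eqP h; case: eqP => // e; rewrite e in h.
Qed.

(** The shift by a cancels in the degree lam_i - nu_j - i + j and makes both the row offsets and the
    columns natural numbers. *)
Lemma skew_schur_flag_minor (lam nu : k.-tuple nat) (a : nat) :
    (forall i, i < k -> nth 0 lam i <= a)%N ->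
    (forall i, i < k -> nth 0 nu i <= a)%N ->
  skew_schur lam nu =
  flag_minor (skew_h mvar k (fun i => a - nth 0 lam i + i)%N)
    (mkseq (fun j => a - nth 0 nu j + j)%N k).
Proof.
move=> hlam hnu; rewrite (@flag_minorE _ _ k) ?size_mkseq //; congr (\det _).
apply/matrixP => i j; rewrite !mxE nth_mkseq // /skew_h !(tnth_nth 0%N).
have hi := hlam i (ltn_ord i); have hj := hnu j (ltn_ord j).
set z := (X in complete_symz _ X); set z' := (X in hsymz _ _ X).
have -> : z' = z by rewrite /z /z'; lia.
by rewrite /complete_symz /hsymz; case: z => // d; apply: complete_sym_hsym.
Qed.

End SkewSchur.

(** * Reasoning about programs *)

Fixpoint reads (e : expr) : seq nat :=
  match e with
  | Lit _ => [::]
  | Read r e1 => r :: reads e1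
  | Add e1 e2 | Defs.Sub e1 e2 | Mul e1 e2 => reads e1 ++ reads e2
  end.

Lemma expr_value_frame (W : seq nat) (s s' : store) e :
  (forall r : nat, r \notin W -> s' r =1 s r) -> ~~ has (mem W) (reads e) ->
  expr_value s' e = expr_value s e.
Proof.
move=> h; elim: e => //= [r e IH|e1 h1 e2 h2|e1 h1 e2 h2|e1 h1 e2 h2].
- by rewrite negb_or => /andP[hr /IH ->]; rewrite h.
- by rewrite has_cat negb_or => /andP[/h1 -> /h2 ->].
- by rewrite has_cat negb_or => /andP[/h1 -> /h2 ->].
- by rewrite has_cat negb_or => /andP[/h1 -> /h2 ->].
Qed.

Section WeakestPrecondition.
Variable B : nat.

(** Total correctness with a budget of m steps. *)
Definition wp (p : cmd) (m : nat) (s : store) (c : circuit)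
    (Q : store -> circuit -> Prop) : Prop :=
  exists s' c' m', [/\ run B p s c s' c' m', m' <= m & Q s' c'].

Lemma wp_weaken p m m' s c (Q Q' : store -> circuit -> Prop) :
  wp p m s c Q -> m <= m' -> (forall s' c', Q s' c' -> Q' s' c') ->
  wp p m' s c Q'.
Proof.
by move=> [s' [c' [l [h1 h2 h3]]]] hm hQ; exists s', c', l; split; auto;
  apply: leq_trans hm.
Qed.

Lemma wp_frame p m s c (Q : store -> circuit -> Prop) :
  wp p m s c Q ->
  wp p m s c (fun s' c' => [/\ Q s' c',
     forall r : nat, r \notin writes p -> s' r =1 s r & exists d, c' = c ++ d]).
Proof.
move=> [s' [c' [l [h1 h2 h3]]]]; exists s', c', l; split=> //; split=> //.
  exact: run_frame h1.
by have [d -> _] := run_cat h1; exists d.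
Qed.

Lemma wp_skip s c (Q : store -> circuit -> Prop) : Q s c -> wp Skip 1 s c Q.
Proof. by move=> h; exists s, c, 1; split=> //; apply: RunSkip. Qed.

Lemma wp_store r e1 e2 s c (Q : store -> circuit -> Prop) :
  expr_value s e2 <= B + size c ->
  Q (upd s r (expr_value s e1) (expr_value s e2)) c ->
  wp (Store r e1 e2) 1 s c Q.
Proof. by move=> h hQ; do 3!eexists; split; first exact: RunStore. Qed.

Lemma wp_seq p1 p2 m1 m2 s c (Q : store -> circuit -> Prop) :
  wp p1 m1 s c (fun s1 c1 => wp p2 m2 s1 c1 Q) -> wp (Seq p1 p2) (m1 + m2) s c Q.
Proof.
move=> [s1 [c1 [l1 [h1 hm1 [s2 [c2 [l2 [h2 hm2 hQ]]]]]]]].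
by exists s2, c2, (l1 + l2); split; [exact: RunSeq h1 h2 | rewrite leq_add |].
Qed.

Lemma wp_if e p1 p2 m1 m2 s c (Q : store -> circuit -> Prop) :
  (expr_value s e != 0 -> wp p1 m1 s c Q) ->
  (expr_value s e = 0 -> wp p2 m2 s c Q) -> wp (If e p1 p2) (m1 + m2).+1 s c Q.
Proof.
move=> h1 h2.
have [s' [c' [l [h hm hQ]]]] :
    wp (if expr_value s e != 0 then p1 else p2) (m1 + m2) s c Q.
  case: eqP => [/h2|/eqP/h1] h; apply: wp_weaken h _ _ => //;
    by rewrite ?leq_addl ?leq_addr.
by exists s', c', l.+1; split=> //; apply: RunIf.
Qed.

Definition For (v : nat) (e : expr) (p : cmd) : cmd :=
  Seq (Store v (Lit 0) (Lit 0))
    (While (Defs.Sub e (Read v (Lit 0)))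
       (Seq p (Store v (Lit 0) (Add (Read v (Lit 0)) (Lit 1))))).

(** In the budget, each round pays for the body, the increment and the test, and the final 2 for the
    initialization and the last test. It uses an upper bound [X] of the number of rounds, so that
    costs become polynomials in one variable. *)
Lemma wp_for (Inv : nat -> store -> circuit -> Prop) (v : nat) e p N X mb
    (s0 : store) c0 :
  N <= X -> N <= B -> v \notin writes p ->
  (forall s : store, (forall r : nat, r \notin v :: writes p -> s r =1 s0 r) ->
     expr_value s e = N) ->
  (forall j s (s' : store) c, Inv j s c ->
     (forall r : nat, r != v -> s' r =1 s r) -> Inv j s' c) ->
  Inv 0 s0 c0 ->
  (forall j (s : store) c, j < N ->
     (forall r : nat, r \notin v :: writes p -> s r =1 s0 r) ->
     s v 0 = j -> (exists d, c = c0 ++ d) -> Inv j s c ->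
     wp p mb s c (Inv j.+1)) ->
  wp (For v e p) (X * (mb + 2) + 2) s0 c0 (Inv N).
Proof.
move=> hX hB hv he hInv h0 hstep.
have -> : X * (mb + 2) + 2 = 1 + (1 + X * (mb + 2)) by lia.
apply: wp_seq; apply: wp_store => //=.
pose st (s : store) c j := [/\ j <= N,
   forall r : nat, r \notin v :: writes p -> s r =1 s0 r,
   s v 0 = j, exists d, c = c0 ++ d & Inv j s c].
suff H l : forall j s c, st s c j -> N - j <= l ->
    wp (While (Defs.Sub e (Read v (Lit 0)))
       (Seq p (Store v (Lit 0) (Add (Read v (Lit 0)) (Lit 1)))))
      (1 + l * (mb + 2)) s c (Inv N).
  apply: (H X 0); last by rewrite subn0.
  split=> //.
  - by move=> r hr a; rewrite /upd; move: hr; rewrite inE; case: eqP.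
  - by rewrite /upd !eqxx.
  - by exists [::]; rewrite cats0.
  - by apply: hInv h0 _ => r hr a; rewrite /upd (negbTE hr).
elim: l => [|l IH] j s c [hj hfr hvj hc hI] hl.
  have hjN : j = N by lia.
  exists s, c, 1; split=> //; last by rewrite -hjN.
  by apply: RunWhileStop; rewrite /= (he _ hfr) hvj hjN subnn.
case: (ltnP j N) => hjN; last first.
  have {}hjN : j = N by lia.
  exists s, c, 1; split=> //; last by rewrite -hjN.
  by apply: RunWhileStop; rewrite /= (he _ hfr) hvj hjN subnn.
have /wp_frame [s1 [c1 [m1 [r1 hm1 [hI1 hf1 [d1 hd1]]]]]] :=
  hstep _ _ _ hjN hfr hvj hc hI.
have hv1 : s1 v 0 = j by rewrite hf1.
pose s2 := upd s1 v 0 (j + 1).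
have r2 : run B (Store v (Lit 0) (Add (Read v (Lit 0)) (Lit 1))) s1 c1 s2 c1 1.
  have -> : s2 = upd s1 v (expr_value s1 (Lit 0))
      (expr_value s1 (Add (Read v (Lit 0)) (Lit 1))) by rewrite /= hv1.
  by apply: RunStore; rewrite /= hv1; lia.
have [||s3 [c3 [m3 [r3 hm3 h3]]]] := IH j.+1 s2 c1.
- split=> //.
  + move=> r hr a; move: (hr); rewrite inE negb_or => /andP[hr1 hr2].
    by rewrite /s2 /upd (negbTE hr1) /= hf1 // hfr.
  + by rewrite /s2 /upd !eqxx addn1.
  + by case: hc => d hd; exists (d ++ d1); rewrite hd1 hd catA.
  + by apply: hInv hI1 _ => r hr a; rewrite /s2 /upd (negbTE hr).
- by lia.
exists s3, c3, (m1 + 1 + m3).+1; split=> //; last by rewrite mulSn; lia.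
apply: RunWhileStep r3; first by rewrite /= (he _ hfr) hvj; lia.
exact: RunSeq r1 r2.
Qed.

End WeakestPrecondition.

(** * Wires and the polynomials that they carry *)

Section Wires.
Variable k : nat.
Local Open Scope ring_scope.

Local Notation xs := (formal_vars k).

Lemma circuit_values_rcons c g : circuit_values xs (rcons c g) =
  rcons (circuit_values xs c) (gate_value xs (circuit_values xs c) g).
Proof. by rewrite /circuit_values -cats1 foldl_cat. Qed.

Lemma size_circuit_values c : size (circuit_values xs c) = size c.
Proof.
elim/last_ind: c => // c g IH.
by rewrite circuit_values_rcons !size_rcons IH.
Qed.

Lemma wf_from_rcons j c g : wf_from k j (rcons c g) =
  wf_from k j c && wf_operand k (j + size c) (gleft g)
    && wf_operand k (j + size c) (gright g).
Proof.
elim: c j => [|h c IH] j /=; first by rewrite addn0 andbT.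
by rewrite IH addSnnS !andbA.
Qed.

Definition wire_value (c : circuit) (j : nat) (u : ratfun k) :=
  (j < size c)%N /\ (circuit_values xs c)`_j = u.

Lemma wire_value_cat c d j u : wire_value c j u -> wire_value (c ++ d) j u.
Proof.
move=> [h1 h2]; elim/last_ind: d => [|d g [IH1 IH2]]; first by rewrite cats0.
rewrite -rcons_cat; split; first by rewrite size_rcons ltnS ltnW.
by rewrite circuit_values_rcons nth_rcons size_circuit_values IH1.
Qed.

Definition good_state (s : store) (c : circuit) :=
  s 3 0 = size c /\ wf_from k 0 c.

Definition operand_denotes (c : circuit) (o : operand) (u : ratfun k) :=
  wf_operand k (size c) o /\ operand_value xs (circuit_values xs c) o = u.

Definition gate_fun (op : gate_op) (u v : ratfun k) : ratfun k :=
  match op with GAdd => u + v | GMul => u * v | GDiv => u / v end.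

Definition emit (op : gate_op) (o1 o2 : operand_expr) : cmd :=
  Seq (Emit op o1 o2) (Store 3 (Lit 0) (Add (Read 3 (Lit 0)) (Lit 1))).

Lemma wp_emit B op o1 o2 u1 u2 s c (Q : store -> circuit -> Prop) :
  good_state s c ->
  operand_denotes c (operand_of s o1) u1 ->
  operand_denotes c (operand_of s o2) u2 ->
  (forall (s' : store) c', (forall r : nat, r \notin [:: 3]%N -> s' r =1 s r) ->
     good_state s' c' -> size c' = (size c).+1 -> (exists d, c' = c ++ d) ->
     wire_value c' (size c) (gate_fun op u1 u2) -> Q s' c') ->
  wp B (emit op o1 o2) 2 s c Q.
Proof.
move=> [h3 hwf] [wf1 v1] [wf2 v2] hQ; apply: (@wp_seq _ _ _ 1 1).
do 3!eexists; split; first exact: RunEmit.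
  by [].
set c' := rcons _ _.
have hs : size c' = (size c).+1 by rewrite size_rcons.
apply: wp_store; rewrite /= h3 addn1; first by rewrite hs leq_addl.
apply: hQ => //.
- by move=> r hr a; rewrite /upd; move: hr; rewrite inE => /negbTE ->.
- split; first by rewrite hs.
  by rewrite wf_from_rcons hwf add0n wf1 wf2.
- by eexists; rewrite /c' -cats1.
- split; first by rewrite hs.
  rewrite circuit_values_rcons nth_rcons size_circuit_values ltnn eqxx.
  by rewrite /gate_value /= v1 v2; case: (op).
Qed.

(* Table entries: 0 stands for the polynomial 0, and w+1 for the wire w.
   Positivity at the point (1, ..., 1) is what keeps divisors nonzero. *)
Definition represents (c : circuit) (w : nat) (v : {mpoly rat[k]}) : Prop :=
  if w is w'.+1 then
    wire_value c w' (tofrac v) /\ 0 < v.@[fun=> 1]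
  else v = 0.

Lemma represents_cat c d w v : represents c w v -> represents (c ++ d) w v.
Proof. by case: w => //= w [h1 h2]; split=> //; apply: wire_value_cat. Qed.

Lemma represents_leq c w v : represents c w v -> (w <= size c)%N.
Proof. by case: w => //= w [[]]. Qed.

Lemma represents_denotes c w v : represents c w v -> (w != 0)%N ->
  operand_denotes c (Wire (w - 1)) (tofrac v).
Proof. by case: w => //= w [[h1 h2] _] _; rewrite /operand_denotes /= subn1. Qed.

Lemma wire_denotes c j u : wire_value c j u -> operand_denotes c (Wire j) u.
Proof. by []. Qed.

End Wires.

(** * Deletion of columns *)

Section RemainingColumns.
Variables (keep : pred nat) (N : nat).

(* [columns s] enumerates the columns left after the s steps that have
   processed the columns N-1, ..., N-s; column N-s is thus at position N-s when
   its turn comes. *)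
Fixpoint columns (s : nat) : nat -> nat :=
  if s is s'.+1 then
    if keep (N - s) then columns s'
    else fun y => columns s' (y + (N - s <= y))
  else id.

Definition interval (s a r : nat) : seq nat := map (columns s) (iota a r).

Lemma size_interval s a r : size (interval s a r) = r.
Proof. by rewrite size_map size_iota. Qed.

Lemma nth_interval s a r q : q < r -> nth 0 (interval s a r) q = columns s (a + q).
Proof. by move=> hq; rewrite (nth_map 0) ?size_iota // nth_iota. Qed.

Lemma columns_ltn s : {homo columns s : i j / i < j}.
Proof.
elim: s => //= s IH i j hij; case: ifP => _; first exact: IH.
by apply: IH; lia.
Qed.

Lemma columns_leq s : {mono columns s : i j / i <= j}.
Proof. exact: leq_mono (@columns_ltn s). Qed.

Lemma sorted_interval s a r : sorted ltn (interval s a r).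
Proof.
rewrite sorted_map; apply: (sub_sorted _ (iota_ltn_sorted a r)) => i j.
exact: columns_ltn.
Qed.

Lemma columns_small s y : s <= N -> y < N - s -> columns s y = y.
Proof.
elim: s => //= s IH hs hy; have hy' : y < N - s by lia.
case: ifP => _; first exact: IH (ltnW hs) hy'.
by rewrite leqNgt hy addn0; apply: IH (ltnW hs) hy'.
Qed.

(** At s = N this says that the columns finally in front are exactly those to keep. *)
Lemma columns_filter s : s <= N ->
  interval s (N - s) (count keep (iota (N - s) s)) = filter keep (iota (N - s) s).
Proof.
elim: s => //= s IH hs; have e : (N - s.+1).+1 = N - s by lia.
rewrite e; have c0 : columns s (N - s.+1) = N - s.+1 by apply: columns_small; lia.
case hk: (keep _); rewrite /interval /= hk.
  by rewrite c0 e; congr (_ :: _); apply: IH; lia.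
rewrite -IH; last by lia.
rewrite /interval add0n; move: (count _ _) => m.
have -> : iota (N - s) m = map (addn 1) (iota (N - s.+1) m) by rewrite -iotaDl add1n e.
rewrite -map_comp.
apply/eq_in_map => y; rewrite mem_iota => /andP[hy _] /=.
by rewrite hy addnC.
Qed.

Lemma interval_deleted s a r : ~~ keep (N - s.+1) ->
  [/\ a + r <= N - s.+1 -> interval s.+1 a r = interval s a r
    & N - s.+1 <= a -> interval s.+1 a r = interval s a.+1 r].
Proof.
move=> /negbTE hk; rewrite /interval /= hk; split=> h.
  by apply/eq_in_map => y; rewrite mem_iota => hy /=; congr (columns _ _); lia.
rewrite -[a.+1]add1n iotaDl -map_comp.
apply/eq_in_map => y; rewrite mem_iota => hy /=; congr (columns _ _); lia.
Qed.

Lemma interval_cat s a r1 r2 :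
  interval s a (r1 + r2) = interval s a r1 ++ interval s (a + r1) r2.
Proof. by rewrite /interval iotaD map_cat. Qed.

End RemainingColumns.

(** Read in the positions before the deletion, the new interval is a, S1, S2, b with b at position a
    + r and c removed between S1 and S2. The factors taken after the deletion have length r-1, so
    the table can be filled by increasing r. *)
Lemma pluecker_deleted (R : comNzRingType) (F : nat -> nat -> R) keep N s a r :
  let D s a r := flag_minor F (interval keep N s a r) in
  ~~ keep (N - s.+1) -> a < N - s.+1 < a + r ->
  (D s.+1 a r * D s a.+1 r.-1
   = D s.+1 a r.-1 * D s a.+1 r + D s.+1 a.+1 r.-1 * D s a r)%R.
Proof.
move=> D hk hc; set c := N - s.+1 in hk hc.
pose p := c - a.+1; pose q := a + r - c.+1.
have er : r = (p + q).+2 by rewrite /p /q; lia.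
have ec : c = a.+1 + p by rewrite /p; lia.
pose I := interval keep N.
have low b m : b + m <= c -> I s.+1 b m = I s b m by case: (interval_deleted b m hk).
have high b m : c <= b -> I s.+1 b m = I s b.+1 m by case: (interval_deleted b m hk).
have catI t b m1 m2 : I t b (m1 + m2) = I t b m1 ++ I t (b + m1) m2.
  exact: interval_cat.
have cons t b m : I t b m.+1 = columns keep N t b :: I t b.+1 m by [].
have one t b : I t b 1 = [:: columns keep N t b] by [].
pose S1 := I s a.+1 p; pose S2 := I s c.+1 q.
have e1 : I s.+1 a r = columns keep N s a :: S1 ++ S2 ++ [:: columns keep N s (a + r)].
  have -> : r = p.+1 + (q + 1) by lia.
  rewrite catI low; last by lia.
  rewrite cons -/S1 addnS -addSn -ec high // catI one.
  by congr (_ :: _ ++ _ ++ [:: columns _ _ _ _]); lia.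
have e2 : I s a.+1 r.-1 = S1 ++ columns keep N s c :: S2.
  have -> : r.-1 = p + q.+1 by lia.
  by rewrite catI -ec cons.
have e3 : I s.+1 a r.-1 = columns keep N s a :: S1 ++ S2.
  have -> : r.-1 = p.+1 + q by lia.
  rewrite catI low; last by lia.
  by rewrite cons high; [congr (_ :: _ ++ I _ _ _)|]; lia.
have e4 : I s a.+1 r = S1 ++ columns keep N s c :: S2 ++ [:: columns keep N s (a + r)].
  have -> : r = p + (q.+1 + 1) by lia.
  rewrite catI -ec.
  rewrite [X in _ ++ X]catI cons one /=.
  by congr (_ ++ _ :: _ ++ [:: columns _ _ _ _]); lia.
have e5 : I s.+1 a.+1 r.-1 = S1 ++ S2 ++ [:: columns keep N s (a + r)].
  have -> : r.-1 = p + (q + 1) by lia.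
  rewrite catI low; last by lia.
  rewrite -ec high // [X in _ ++ X]catI one.
  by congr (_ ++ _ ++ [:: columns _ _ _ _]); lia.
have e6 : I s a r = columns keep N s a :: S1 ++ columns keep N s c :: S2.
  have -> : r = p.+1 + q.+1 by lia.
  rewrite catI cons cons.
  by rewrite addnS -addSn -ec.
by rewrite /D -!/(I _ _ _) e1 e2 e3 e4 e5 e6 pluecker mulrC.
Qed.

Local Notation "''V' i" := (Read i (Lit 0)) (at level 0, i at level 0).
Local Notation "e1 ++e e2" := (Add e1 e2) (at level 50, left associativity).
Local Notation "e1 --e e2" := (Defs.Sub e1 e2) (at level 50, left associativity).
Local Notation "e1 **e e2" := (Mul e1 e2) (at level 40, left associativity).
Local Notation "p1 ;; p2" := (Seq p1 p2) (at level 61, right associativity).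

(* Array 3 counts the emitted gates, 4 to 6 hold n, the number N of columns and
   the base M = 2n+1 of the addresses, 10 to 15 are loop counters.  Array 20
   has at [(s M + a) M + r] the flag minor of the interval [a, a+r) after step s
   of the deletion, array 21 marks the columns to keep, array 22 collects the
   initial table of the skew stage. *)
Definition cell (s a r : expr) : expr :=
  Read 20 ((s **e 'V 6 ++e a) **e 'V 6 ++e r).
Definition set_cell (s a r v : expr) : cmd :=
  Store 20 ((s **e 'V 6 ++e a) **e 'V 6 ++e r) v.
Definition wire (e : expr) : operand_expr := EWire (e --e Lit 1).

(* D = 0 is possible while the minor to compute is not 0, and then the product
   C D is left out; if another of the factors is 0, so is that minor. *)
Definition del_cell : cmd :=
  let s := 'V 10 in let s1 := s ++e Lit 1 in
  let r := 'V 11 in let r1 := r --e Lit 1 in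
  let a := 'V 12 in let a1 := a ++e Lit 1 in
  let c := 'V 5 --e s1 in
  let A := cell s1 a r1 in let B := cell s a1 r in
  let C := cell s1 a1 r1 in let D := cell s a r in
  let E := cell s a1 r1 in
  If (Read 21 c ++e (c ++e Lit 1 --e (a ++e r))) (set_cell s1 a r D)
  (If (c --e a)
    (If ((A **e B) **e (C **e E))
      (emit GMul (wire A) (wire B) ;;
       If D (emit GMul (wire C) (wire D) ;;
             emit GAdd (EWire ('V 3 --e Lit 2)) (EWire ('V 3 --e Lit 1)))
            Skip ;;
       emit GDiv (EWire ('V 3 --e Lit 1)) (wire E) ;;
       set_cell s1 a r 'V 3)
      (set_cell s1 a r (Lit 0)))
    (set_cell s1 a r B)).

Definition delete_columns : cmd :=
  For 10 'V 5 (For 11 ('V 0 ++e Lit 1) (For 12 ('V 5 --e 'V 10) del_cell)).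

Lemma operand_of_wire st e : operand_of st (wire e) = Wire (expr_value st e - 1).
Proof. by []. Qed.

Lemma expr_valueM st e1 e2 :
  expr_value st (e1 **e e2) = expr_value st e1 * expr_value st e2.
Proof. by []. Qed.

Section Addresses.
Variable M : nat.

Definition address (s a r : nat) := (s * M + a) * M + r.

Lemma address_inj s a r s' a' r' : a < M -> r < M -> a' < M -> r' < M ->
  address s a r = address s' a' r' -> [/\ s = s', a = a' & r = r'].
Proof.
rewrite /address => ha hr ha' hr' h.
have M0 : 0 < M by lia.
have e : s * M + a = s' * M + a'.
  have := congr1 (fun x => x %/ M) h.
  by rewrite !divnMDl // !(divn_small hr, divn_small hr') !addn0.
have er : r = r' by move: h; rewrite e; lia.
have es : s = s'.
  have := congr1 (fun x => x %/ M) e.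
  by rewrite !divnMDl // !(divn_small ha, divn_small ha') !addn0.
by split=> //; move: e; rewrite es; lia.
Qed.

Lemma address_neq (s a r s' a' r' : nat) : a < M -> r < M -> a' < M -> r' < M ->
  [|| s != s', a != a' | r != r'] -> address s a r != address s' a' r'.
Proof.
move=> h1 h2 h3 h4; apply: contraTN => /eqP /address_inj[] // -> -> ->.
by rewrite !eqxx.
Qed.

(** Deletion writes only cells with s > 0, so the initial table, which lies below M * M, survives
    and starts every deletion of the straight stage. *)
Lemma address_gt_base s a r : M * M <= address s.+1 a r.
Proof. by rewrite /address; nia. Qed.

End Addresses.

(** * Correctness of a deletion stage *)

Section Deletion.
Variables (k : nat) (F : nat -> nat -> {mpoly rat[k]}) (nz : pred (seq nat)).
Local Notation D := (flag_minor F).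
(* [nz] is the combinatorial criterion for a minor to be nonzero. *)
Hypothesis nz0 : forall cs, sorted ltn cs -> ~~ nz cs -> D cs = 0%R.
Hypothesis nz_mono : forall cs cs', nz cs -> size cs' <= size cs ->
  (forall q, q < size cs' -> nth 0 cs q <= nth 0 cs' q) -> nz cs'.
Variables (keep : pred nat) (N M B : nat).
Hypotheses (NM : N < M) (kM : k < M) (NB : N <= B) (kB : k < B).

Local Notation I := (interval keep N).
Local Notation address := (address M).

Definition cell_ok (st : store) (c : circuit) (s a r : nat) : Prop :=
  represents c (st 20 (address s a r)) (D (I s a r)) /\
  (nz (I s a r) -> st 20 (address s a r) != 0).

Lemma cell_ok_frame st st' c d s a r : st' 20 (address s a r) = st 20 (address s a r) ->
  cell_ok st c s a r -> cell_ok st' (c ++ d) s a r.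
Proof. by rewrite /cell_ok => -> [h1 h2]; split=> //; apply: represents_cat. Qed.

Definition control (st : store) (s r a : nat) :=
  [/\ st 0 0 = k, st 5 0 = N, st 6 0 = M, forall y, (st 21 y != 0) = keep y &
   [/\ st 10 0 = s, st 11 0 = r & st 12 0 = a]].

(** Each of these four minors has columns at least as large, position by position, as the leading
    columns of the target aTb. The fifth, aTc, is absent: its last column lies to the left of b. *)
Lemma nz_deleted s a r : ~~ keep (N - s.+1) -> a < N - s.+1 < a + r ->
  nz (I s.+1 a r) ->
  [/\ nz (I s.+1 a r.-1), nz (I s a.+1 r), nz (I s.+1 a.+1 r.-1) & nz (I s a.+1 r.-1)].
Proof.
move=> hk hc hn.
have E y : columns keep N s.+1 y = columns keep N s (y + (N - s.+1 <= y)).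
  by rewrite /= (negbTE hk).
have H t b m : m <= r -> (forall q, q < m ->
    columns keep N s.+1 (a + q) <= columns keep N t (b + q)) -> nz (I t b m).
  move=> hm h; apply: nz_mono hn _ _; rewrite !size_interval // => q hq.
  by rewrite !nth_interval ?h //; apply: leq_trans hm.
by split; apply: H; try lia; move=> q hq; rewrite ?E columns_leq; lia.
Qed.

(** Positivity at (1, ..., 1) passes to an exact quotient without any knowledge of its
    coefficients. *)
Lemma mpoly_div_tofrac (u v w : {mpoly rat[k]}) :
  (u * v = w -> 0 < v.@[fun=> 1] -> 0 < w.@[fun=> 1] ->
   tofrac w / tofrac v = tofrac u /\ 0 < u.@[fun=> 1])%R.
Proof.
move=> <- hv; rewrite mevalM pmulr_lgt0 // => hu; split=> //.
rewrite tofracM mulfK // tofrac_eq0; apply: contraTneq hv => ->.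
by rewrite meval0 ltxx.
Qed.

Lemma wp_set_cell st c s a r e x w (Q : store -> circuit -> Prop) :
  address s a r = x -> represents c w (D (I s a r)) ->
  (nz (I s a r) -> w != 0) -> expr_value st e = w ->
  good_state k st c ->
  (forall es ea er, expr_value st es = s -> expr_value st ea = a ->
     expr_value st er = r -> st 6 0 = M ->
  (forall st', good_state k st' c -> cell_ok st' c s a r ->
     (forall y : nat, y != x -> st' 20 y = st 20 y) -> Q st' c) ->
  wp B (set_cell es ea er e) 1 st c Q).
Proof.
move=> hx hr hn he [g1 g2] es ea er hs ha hrr hM hQ; apply: wp_store; rewrite /= ?he.
  by apply: leq_trans (represents_leq hr) (leq_addl _ _).
rewrite hs ha hrr hM -/(address s a r) hx; apply: hQ.
- by split.
- by rewrite /cell_ok /upd hx !eqxx.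
- by move=> y hy; rewrite /upd (negbTE hy) andbF.
Qed.

Lemma wp_del_cell st c s a r :
  s < N -> a < N - s -> r <= k ->
  good_state k st c -> control st s r a ->
  (forall a' r', a' <= N - s -> r' <= k -> cell_ok st c s a' r') ->
  (forall a' r', a' < N - s -> r' < r -> cell_ok st c s.+1 a' r') ->
  wp B del_cell 20 st c (fun st' c' => [/\ good_state k st' c',
     cell_ok st' c' s.+1 a r &
     forall y : nat, y != address s.+1 a r -> st' 20 y = st 20 y]).
Proof.
move=> hs ha hr hg [h0 h5 h6 h21 [h10 h11 h12]] hold hnew.
pose cc := N - s.+1.
(* The nesting of tests and gates in [del_cell] adds up to 17 steps, rounded up to 20. *)
apply: (@wp_weaken _ _ (1 + ((2 + ((2 + 2 + 1).+1 + (2 + 1)) + 1).+1 + 1).+1).+1);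
  [|by []|exact: (fun _ _ h => h)].
have setD w e : represents c w (D (I s.+1 a r)) -> (nz (I s.+1 a r) -> w != 0) ->
   expr_value st e = w ->
   wp B (set_cell ('V 10 ++e Lit 1) 'V 12 'V 11 e) 1 st c (fun st' c' =>
     [/\ good_state k st' c', cell_ok st' c' s.+1 a r &
     forall y : nat, y != address s.+1 a r -> st' 20 y = st 20 y]).
  move=> h1 h2 h3; apply: (wp_set_cell (erefl _) h1 h2 h3 hg) => //=.
  by rewrite h10 addn1.
apply: wp_if.
  rewrite /= h5 h10 h11 h12 addn1 -/cc => hcond.
  have e : I s.+1 a r = I s a r.
    case hk : (keep cc); first by rewrite /interval /= -/cc hk.
    have [-> //] := interval_deleted a r (negbT hk).
    by move: hcond (h21 cc); rewrite hk -/cc; lia.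
  have [h1 h2] := hold a r (ltnW ha) hr.
  by apply: (setD (st 20 (address s a r))); rewrite ?e //= h6 h10 h11 h12.
rewrite /= h5 h10 h11 h12 addn1 -/cc => hcond.
have hk : ~~ keep cc by rewrite -h21; lia.
have har : cc < a + r by lia.
apply: wp_if; last first.
  rewrite /= h5 h10 h12 addn1 -/cc => hcond2.
  have [_ e] := interval_deleted a r hk.
  have [h1 h2] := hold a.+1 r ha hr.
  rewrite -e in h1 h2; last by rewrite -/cc; lia.
  by apply: (setD (st 20 (address s a.+1 r))); rewrite //= h6 h10 h11 h12 addn1.
rewrite /= h5 h10 h12 addn1 -/cc => hcond2.
have hac : a < cc by lia.
have hacr : a < cc < a + r by rewrite hac.
have pl := pluecker_deleted F hk hacr.
have nzs := nz_deleted hk hacr.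
have hr1 : r.-1 < r by lia.
set wA := st 20 (address s.+1 a r.-1); set wB := st 20 (address s a.+1 r).
set wC := st 20 (address s.+1 a.+1 r.-1); set wD := st 20 (address s a r).
set wE := st 20 (address s a.+1 r.-1).
have [A1 A2] : cell_ok st c s.+1 a r.-1 by apply: hnew.
have [B1 B2] : cell_ok st c s a.+1 r by apply: hold.
have [C1 C2] : cell_ok st c s.+1 a.+1 r.-1 by apply: hnew => //; move: hac; rewrite /cc; lia.
have [D1 D2] : cell_ok st c s a r by apply: hold => //; apply: ltnW.
have [E1 E2] : cell_ok st c s a.+1 r.-1 by apply: hold; lia.
rewrite -/wA -/wB -/wC -/wD -/wE in A1 A2 B1 B2 C1 C2 D1 D2 E1 E2.
have vA : expr_value st (cell ('V 10 ++e Lit 1) 'V 12 ('V 11 --e Lit 1)) = wA.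
  by rewrite /= h6 h10 h11 h12 addn1 subn1.
have vB : expr_value st (cell 'V 10 ('V 12 ++e Lit 1) 'V 11) = wB.
  by rewrite /= h6 h10 h11 h12 addn1.
have vC : expr_value st (cell ('V 10 ++e Lit 1) ('V 12 ++e Lit 1) ('V 11 --e Lit 1)) = wC.
  by rewrite /= h6 h10 h11 h12 !addn1 subn1.
have vD : expr_value st (cell 'V 10 'V 12 'V 11) = wD.
  by rewrite /= h6 h10 h11 h12.
have vE : expr_value st (cell 'V 10 ('V 12 ++e Lit 1) ('V 11 --e Lit 1)) = wE.
  by rewrite /= h6 h10 h11 h12 addn1 subn1.
apply: wp_if; last first.
  rewrite !expr_valueM vA vB vC vE => hz.
  (* One of A, B, C, E is 0, which refutes the criterion for the target. *)
  have hnz : ~~ nz (I s.+1 a r).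
    apply/negP => /nzs[/A2 a0 /B2 b0 /C2 c0 /E2 e0]; move: hz; apply/eqP.
    by rewrite !muln_eq0 !negb_or a0 b0 c0 e0.
  apply: (setD 0) => //=; last by move=> h; rewrite h in hnz.
  by apply: nz0 => //; apply: sorted_interval.
rewrite !expr_valueM vA vB vC vE !muln_eq0 !negb_or => /andP[/andP[a0 b0] /andP[c0 e0]].
set dA := D _ in A1; set dB := D _ in B1; set dC := D _ in C1.
set dD := D _ in D1; set dE := D _ in E1; rewrite -/dA -/dB -/dC -/dD -/dE in pl.
have pos w (p : {mpoly rat[k]}) :
    represents c w p -> w != 0 -> (0 < p.@[fun=> 1])%R.
  by case: w => //= w [].
have pA := pos _ _ A1 a0; have pB := pos _ _ B1 b0.
have pC := pos _ _ C1 c0; have pE := pos _ _ E1 e0.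
pose X := (dA * dB + dC * dD)%R.
pose mid (st2 : store) c2 := [/\ forall r' : nat, r' \notin [:: 3] -> st2 r' =1 st r',
  good_state k st2 c2, exists d, c2 = c ++ d, 0 < size c2 &
  wire_value c2 (size c2 - 1) (tofrac X)].
have fr (st' : store) e : (forall r' : nat, r' \notin [:: 3] -> st' r' =1 st r') ->
    ~~ has (mem [:: 3]) (reads e) -> expr_value st' e = expr_value st e.
  exact: expr_value_frame.
(* A B is positive, while C D is only nonnegative since D may be 0. *)
have pX : (0 < X.@[fun=> 1])%R.
  rewrite mevalD !mevalM ltr_pwDl ?mulr_gt0 //.
  by case: (wD) D1 => [->|w /pos pD]; rewrite ?meval0 ?mulr0 // mulr_ge0 ?ltW ?pD.
apply: wp_seq; apply: (wp_emit _ hg).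
- by rewrite operand_of_wire vA; apply: represents_denotes A1 a0.
- by rewrite operand_of_wire vB; apply: represents_denotes B1 b0.
move=> st1 c1 f1 g1 s1 [d1 e1] w1.
apply: wp_seq; apply: (@wp_weaken _ _ _ _ _ _ mid); [|exact: leqnn|].
  apply: wp_if; rewrite (fr _ _ f1) // vD => hD; last first.
    apply: wp_skip; split=> //; [by exists d1|by rewrite s1|].
    rewrite s1 subn1 /=; move: D1; rewrite hD /= /X => ->.
    by rewrite mulr0 addr0 tofracM.
  apply: wp_seq; apply: (wp_emit _ g1).
  - rewrite operand_of_wire (fr _ (cell _ _ _) f1) // vC e1.
    exact: represents_denotes (represents_cat _ C1) c0.
  - rewrite operand_of_wire (fr _ (cell _ _ _) f1) // vD e1.
    exact: represents_denotes (represents_cat _ D1) hD.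
  move=> st2 c2 f2 g2 s2 [d2 e2] w2.
  apply: (wp_emit _ g2).
  - rewrite /= (proj1 g2) s2 s1 e2 subSS subn1; exact: wire_denotes (wire_value_cat _ w1).
  - rewrite /= (proj1 g2) s2 subn1; exact: wire_denotes w2.
  move=> st3 c3 f3 g3 s3 [d3 e3] w3; split=> //.
  - by move=> r' hr' y; rewrite f3 // f2 // f1.
  - by exists (d1 ++ d2 ++ d3); rewrite e3 e2 e1 !catA.
  - by rewrite s3.
  - by rewrite s3 subn1 /= /X tofracD !tofracM.
move=> st2 c2 [f2 g2 [d2 e2] s2 w2].
have [q1 q2] := mpoly_div_tofrac pl pE pX.
apply: wp_seq; apply: (wp_emit _ g2).
- by rewrite /= (proj1 g2); exact: wire_denotes w2.
- rewrite operand_of_wire (fr _ (cell _ _ _) f2) // vE e2.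
  exact: represents_denotes (represents_cat _ E1) e0.
move=> st3 c3 f3 g3 s3 [d3 e3] /=; rewrite q1 => w3.
have f3' (r' : nat) : r' \notin [:: 3] -> st3 r' =1 st r' by move=> hr' y; rewrite f3 // f2.
apply: (@wp_set_cell st3 c3 s.+1 a r _ _ (size c3)) => //=.
- by rewrite s3.
- by rewrite s3.
- exact: (proj1 g3).
- by rewrite f3' // h10 addn1.
- by rewrite f3'.
- by rewrite f3'.
- by rewrite f3'.
by move=> st4 g4 cell4 f4; split=> // y hy; rewrite f4 // f3'.
Qed.

Lemma good_state_frame (st st' : store) c : st' 3 =1 st 3 ->
  good_state k st c -> good_state k st' c.
Proof. by move=> h [h1 h2]; split=> //; rewrite h. Qed.

Definition base_kept (st0 st : store) := forall x, x < M * M -> st 20 x = st0 20 x.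

(** Intervals may run past column N; the columns there are never deleted. A cell at a uses position
    a+1 of the previous step, so the valid range of a shrinks by one per step, down to a = 0 after N
    steps. *)
Lemma wp_delete_columns st c X : N <= X -> k < X ->
  good_state k st c -> st 0 0 = k -> st 5 0 = N -> st 6 0 = M ->
  (forall y, (st 21 y != 0) = keep y) ->
  (forall a r, a <= N -> r <= k -> cell_ok st c 0 a r) ->
  wp B delete_columns (X * (X * (X * 22 + 2 + 2) + 2 + 2) + 2) st c
    (fun st' c' => [/\ good_state k st' c', cell_ok st' c' N 0 k &
       base_kept st st']).
Proof.
move=> NX kX hg h0 h5 h6 h21 hbase.
pose old j st' c' := forall a r, a <= N - j -> r <= k -> cell_ok st' c' j a r.
pose new j i st' c' := forall a r, a < N - j -> r < i -> r <= k ->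
  cell_ok st' c' j.+1 a r.
have old_frame j (st1 st2 : store) c1 d :
    (forall a r, a < M -> r < M ->
       st2 20 (address j a r) = st1 20 (address j a r)) ->
    old j st1 c1 -> old j st2 (c1 ++ d).
  move=> h ho a r ha hr; apply: cell_ok_frame (ho _ _ ha hr); apply: h; lia.
have new_frame j i (st1 st2 : store) c1 d :
    (forall a r, a < M -> r < M -> r < i ->
       st2 20 (address j.+1 a r) = st1 20 (address j.+1 a r)) ->
    new j i st1 c1 -> new j i st2 (c1 ++ d).
  move=> h ho a r ha hr hrk; apply: cell_ok_frame (ho _ _ ha hr hrk); apply: h; lia.
pose Inv0 j st' c' := [/\ good_state k st' c', old j st' c' & base_kept st st'].
pose Inv1 j i st' c' := [/\ good_state k st' c', old j st' c',
  base_kept st st' & new j i st' c'].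
pose Inv2 j i h st' c' := [/\ good_state k st' c', old j st' c', base_kept st st',
  new j i st' c' & forall a, a < h -> cell_ok st' c' j.+1 a i].
apply: (@wp_weaken _ _ _ _ _ _ (Inv0 N)); [|exact: leqnn|]; last first.
  move=> st' c' [h1 h2 h3]; split=> //; apply: h2; lia.
apply: wp_for => //.
- by move=> s hf; rewrite /= hf.
- move=> j s s' c' [g1 o1 b1] hf; split.
  + by apply: good_state_frame g1; apply: hf.
  + by rewrite -[c']cats0; apply: old_frame o1 => *; rewrite hf.
  + by move=> x hx; rewrite hf // b1.
- by split=> // a r; rewrite subn0; apply: hbase.
move=> j st1 c1 hj f1 v1 _ [g1 o1 b1].
apply: (@wp_weaken _ _ _ _ _ _ (Inv1 j k.+1)); [|exact: leqnn|]; last first.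
  move=> st' c' [h1 h2 h3 h4]; split=> // a r ha hr.
  by apply: h4; rewrite ?ltnS //; lia.
apply: wp_for => //.
- by move=> s hf; rewrite /= hf // f1 // h0 addn1.
- move=> i s s' c' [h1 h2 h3 h4] hf; split.
  + by apply: good_state_frame h1; apply: hf.
  + by rewrite -[c']cats0; apply: old_frame h2 => *; rewrite hf.
  + by move=> x hx; rewrite hf // h3.
  + by rewrite -[c']cats0; apply: new_frame h4 => *; rewrite hf.
move=> i st2 c2 hi f2 v2 _ [g2 o2 b2 n2].
apply: (@wp_weaken _ _ _ _ _ _ (Inv2 j i (N - j))); [|exact: leqnn|]; last first.
  move=> st' c' [h1 h2 h3 h4 h5']; split=> // a r ha hr hrk.
  by move: hr; rewrite ltnS leq_eqVlt => /orP[/eqP ->|hr]; [apply: h5' | apply: h4].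
apply: (@wp_for _ (Inv2 j i) _ _ _ (N - j) X 20) => //.
- by lia.
- by lia.
- by move=> s hf; rewrite /= !hf // !f2 // f1 // h5 v1.
- move=> h s s' c' [h1 h2 h3 h4 h5'] hf; split.
  + by apply: good_state_frame h1; apply: hf.
  + by rewrite -[c']cats0; apply: old_frame h2 => *; rewrite hf.
  + by move=> x hx; rewrite hf // h3.
  + by rewrite -[c']cats0; apply: new_frame h4 => *; rewrite hf.
  + by move=> a ha; rewrite -[c']cats0; apply: cell_ok_frame (h5' _ ha); rewrite hf.
move=> h st3 c3 hh f3 v3 _ [g3 o3 b3 n3 m3].
have hik : i <= k by lia.
have hc : control st3 j i h.
  have fr (r : nat) : r \notin [:: 10; 11; 12; 20; 3] -> st3 r =1 st r.
    move=> hr y; rewrite f3 ?f2 ?f1 //; apply: contra hr;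
    by rewrite /= !inE; lia.
  split; [by rewrite fr|by rewrite fr|by rewrite fr|by move=> y; rewrite fr|].
  by split=> //; rewrite f3 // f2.
have := @wp_del_cell st3 c3 j h i hj hh hik g3 hc o3.
case/(_ _)/wp_frame.
  by move=> a r ha hr; apply: n3 => //; lia.
move=> st4 [c4 [l [r4 hl [[g4 cell4 e4] _ [d e]]]]].
have [hM iM] : h < M /\ i < M by lia.
exists st4, c4, l; split=> //; rewrite e; rewrite e in g4 cell4; split=> //.
- apply: old_frame o3 => a r ha hr; apply: e4.
  by rewrite (address_neq ha hr hM iM) // (ltn_eqF (ltnSn j)).
- by move=> x hx; rewrite e4 ?b3 //; have := address_gt_base M j h i; lia.
- apply: new_frame n3 => a r ha hr hri; apply: e4.
  by rewrite (address_neq ha hr hM iM) // (ltn_eqF hri) !orbT.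
- move=> a; rewrite ltnS leq_eqVlt => /orP[/eqP -> //|ha].
  apply: cell_ok_frame (m3 _ ha); apply: e4.
  by rewrite (address_neq (ltn_trans ha hM) iM hM iM) // (ltn_eqF ha) orbT.
Qed.

End Deletion.

(** * The program *)

(* (x_0...x_{r-1})^a = P_{a,r-1} P_{a-1,r} x_{r-1} / P_{a-1,r-1}, where P_{a,r}
   is the left side *)
Definition base_cell : cmd :=
  let z := Lit 0 in
  let a := 'V 12 in let a1 := a --e Lit 1 in
  let r := 'V 11 in let r1 := r --e Lit 1 in
  If (a **e r)
    (emit GMul (wire (cell z a r1)) (wire (cell z a1 r)) ;;
     emit GMul (EWire ('V 3 --e Lit 1)) (EVar r1) ;;
     emit GDiv (EWire ('V 3 --e Lit 1)) (wire (cell z a1 r1)) ;;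
     set_cell z a r 'V 3)
    (emit GMul (EScalar (Lit 1)) (EScalar (Lit 1)) ;;
     set_cell z a r 'V 3).

Definition base_table : cmd := For 12 'V 6 (For 11 ('V 0 ++e Lit 1) base_cell).

(** The first loop overwrites all marks, which clears those left by the previous interval. Both
    loops share counter 15, which [fill] and [pos] may read. *)
Definition mark (fill len pos : expr) : cmd :=
  For 15 'V 5 (Store 21 'V 15 fill) ;; For 15 len (Store 21 pos (Lit 1)).

(* The guard holds if r = 0 or l_{r-1} < a + r; otherwise the minor is 0. *)
Definition skew_cell : cmd :=
  let r := 'V 13 in let a := 'V 14 in let p := 'V 15 in
  let lam0 := Read 1 (Lit 0) in
  If (a ++e Lit 1 ++e Read 1 (r --e Lit 1) --e lam0 ++e (Lit 1 --e r))
    (mark ('V 0 --e r --e p) r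
       ('V 0 ++e a ++e Read 1 p --e (lam0 ++e p ++e Lit 1)) ;;
     delete_columns ;;
     Store 22 (a **e 'V 6 ++e r) (cell 'V 5 (Lit 0) 'V 0))
    (Store 22 (a **e 'V 6 ++e r) (Lit 0)).

Definition skew_table : cmd :=
  For 13 ('V 0 ++e Lit 1) (For 14 ('V 4 ++e Lit 1) skew_cell).

(** The copy is delayed because the cells with s = 0 hold the straight table until the last skew
    entry has been computed. *)
Definition load_table : cmd :=
  For 13 ('V 0 ++e Lit 1) (For 14 ('V 4 ++e Lit 1)
    (set_cell (Lit 0) 'V 14 'V 13 (Read 22 ('V 14 **e 'V 6 ++e 'V 13)))).

(** The straight stage needs 2n columns, its exponents being at most k-1+a with a <= n; for the last
    deletion n suffice, as lam_0 - nu_j + j < n. The product by 1 at the end makes the result the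
    last gate, wherever its wire was. *)
Definition skew_schur_program : cmd :=
  Store 4 (Lit 0) ('V 0 ++e Read 1 (Lit 0)) ;;
  Store 6 (Lit 0) (Lit 2 **e 'V 4 ++e Lit 1) ;;
  Store 5 (Lit 0) (Lit 2 **e 'V 4) ;;
  base_table ;;
  skew_table ;;
  Store 5 (Lit 0) 'V 4 ;;
  load_table ;;
  mark (Lit 0) 'V 0 (Read 1 (Lit 0) --e Read 2 'V 15 ++e 'V 15) ;;
  delete_columns ;;
  emit GMul (wire (cell 'V 5 (Lit 0) 'V 0)) (EScalar (Lit 1)).

Lemma filter_iota_eq (keep : pred nat) N L : sorted ltn L ->
  (forall y, (y \in L) = (y < N) && keep y) -> filter keep (iota 0 N) = L.
Proof.
move=> hL h; apply: (irr_sorted_eq ltn_trans ltnn) => //.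
  by apply: sorted_filter; [exact: ltn_trans | exact: iota_ltn_sorted].
by move=> y; rewrite h mem_filter mem_iota andbC.
Qed.

Lemma interval_kept keep N L : filter keep (iota 0 N) = L ->
  interval keep N N 0 (size L) = L.
Proof.
move=> <-; rewrite size_filter.
by have := columns_filter keep (leqnn N); rewrite subnn.
Qed.

(** * Correctness and step count of the program *)

Section SkewTable.
Variables (k : nat) (lam nu : k.-tuple nat).
Hypothesis shape : skew_shape lam nu.

Let lam_ i := nth 0 lam i.
Let nu_ i := nth 0 nu i.
Let n := problem_size lam.
Let M := 2 * n + 1.
Let B := M.+1.
Let l i := lam_ 0 - lam_ i + i.

Local Notation D1 := (flag_minor (flagged_h (mvar k))).
Local Notation D2 := (flag_minor (skew_h (mvar k) k l)).

Let nz1 : pred (seq nat) := predT.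
Let nz2 : pred (seq nat) :=
  fun cs => all (fun q => l q <= nth 0 cs q) (iota 0 (size cs)).

Lemma partition_nth (s : seq nat) i j : is_partition s -> i <= j ->
  nth 0 s j <= nth 0 s i.
Proof.
move=> hs hij; case: (ltnP j (size s)) => hj; last by rewrite nth_default.
have geq_trans : transitive geq by move=> x y z /= h1 h2; apply: leq_trans h2 h1.
by apply: (sorted_leq_nth geq_trans leqnn 0 hs) => //; apply: leq_ltn_trans hij hj.
Qed.

Lemma lam_anti i j : i <= j -> lam_ j <= lam_ i.
Proof. by case: shape => _ h _ _; apply: partition_nth. Qed.

Lemma nu_anti i j : i <= j -> nu_ j <= nu_ i.
Proof. by case: shape => _ _ h _; apply: partition_nth. Qed.

Lemma nu_le_lam i : nu_ i <= lam_ i.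
Proof.
case: (ltnP i k) => hi; last by rewrite /nu_ nth_default // size_tuple.
by case: shape => _ _ _ /(_ (Ordinal hi)); rewrite !(tnth_nth 0).
Qed.

Lemma nE : n = k + lam_ 0.
Proof. by rewrite /n /problem_size /lam_ nth0. Qed.

Lemma k_gt0 : 0 < k. Proof. by case: shape. Qed.

Lemma l_homo : {homo l : i j / i <= j}.
Proof. by move=> i j h; rewrite /l; have := lam_anti h; lia. Qed.

Lemma nz2P cs : reflect (forall q, q < size cs -> l q <= nth 0 cs q) (nz2 cs).
Proof.
apply: (iffP allP) => h q; first by move=> hq; apply: h; rewrite mem_iota.
by rewrite mem_iota => /andP[_ /h].
Qed.

Lemma nz2_eq0 cs : sorted ltn cs -> ~~ nz2 cs -> D2 cs = 0%R.
Proof.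
move=> hs /allPn[q]; rewrite mem_iota -ltnNge => /andP[_ hq] h.
apply: (flag_minor_skew_h_eq0 _ _ hq l_homo) h.
by apply: sub_sorted hs => i j /ltnW.
Qed.

Lemma nz2_mono cs cs' : nz2 cs -> size cs' <= size cs ->
  (forall q, q < size cs' -> nth 0 cs q <= nth 0 cs' q) -> nz2 cs'.
Proof.
move=> /nz2P h hs h'; apply/nz2P => q hq; apply: leq_trans (h' _ hq).
exact/h/(leq_trans hq).
Qed.

Definition env (st : store) :=
  [/\ st 0 0 = k, forall y, st 1 y = lam_ y, forall y, st 2 y = nu_ y,
      st 4 0 = n & st 6 0 = M].

Lemma env_frame (st st' : store) (W : seq nat) :
  (forall r : nat, r \notin W -> st' r =1 st r) ->
  ~~ has (mem W) [:: 0; 1; 2; 4; 6] -> env st -> env st'.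
Proof.
move=> h /=; rewrite !negb_or => /and5P[h0 h1 h2 h4 /andP[h6 _]] [e0 e1 e2 e4 e6].
by split=> [|y|y||]; rewrite h.
Qed.

Lemma wp_mark fill len pos st c N R f g :
  st 5 0 = N -> N <= M -> R <= M ->
  good_state k st c ->
  (forall (st' : store) j, (forall r : nat, r \notin [:: 15; 21] -> st' r =1 st r) ->
     st' 15 0 = j -> expr_value st' fill = f j) ->
  (forall j, f j <= B) ->
  (forall (st' : store), (forall r : nat, r \notin [:: 15; 21] -> st' r =1 st r) ->
     expr_value st' len = R) ->
  (forall (st' : store) j, (forall r : nat, r \notin [:: 15; 21] -> st' r =1 st r) ->
     st' 15 0 = j -> expr_value st' pos = g j) ->
  wp B (mark fill len pos) (2 * (M * 3 + 2)) st c (fun st' c' =>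
    good_state k st' c' /\
    forall y, y < N -> (st' 21 y != 0) = (f y != 0) || (y \in mkseq g R)).
Proof.
move=> h5 hN hR hg hf hfB hr hpos; rewrite mul2n -addnn; apply: wp_seq.
pose Inv0 j (st' : store) (c' : circuit) :=
  good_state k st' c' /\ forall y, y < j -> st' 21 y = f y.
have fill_ok : wp B (For 15 'V 5 (Store 21 'V 15 fill)) (M * (1 + 2) + 2) st c (Inv0 N).
  apply: wp_for => //.
  - by apply: leq_trans hN _.
  - by move=> s hfr; rewrite /= hfr.
  - move=> j s s' c' [[g1 g2] h] hfr; split; first by split=> //; rewrite hfr.
    by move=> y hy; rewrite hfr // h.
  move=> j s c' hj hfr hv _ [g1 h]; apply: wp_store; rewrite (hf _ _ hfr hv).
    exact: leq_trans (hfB j) (leq_addr _ _).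
  rewrite /= hv; split=> // y; rewrite ltnS leq_eqVlt /upd /=.
  by case: (y =P j) => [->|_] //= /h.
apply: (wp_weaken (wp_frame fill_ok)); [exact: leqnn|].
move=> st1 c1 [[g1 h1] f1' _].
have f1 (r : nat) : r \notin [:: 15; 21] -> st1 r =1 st r.
  by move=> hr1; apply: f1'; move: hr1; rewrite /= !inE; case: (r == 15); case: (r == 21).
pose Inv1 j (st' : store) (c' : circuit) := good_state k st' c' /\
  forall y, y < N -> (st' 21 y != 0) = (f y != 0) || (y \in mkseq g j).
apply: (@wp_for _ Inv1 _ _ _ R M 1) => //.
- by apply: leq_trans hR _.
- by move=> s hfr; apply: hr => r h y; rewrite hfr // f1.
- move=> j s s' c' [[g2 g3] h] hfr; split; first by split=> //; rewrite hfr.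
  by move=> y hy; rewrite hfr // h.
- by split=> // y hy; rewrite h1 // orbF.
move=> j s c' hj hfr hv _ [g2 h]; apply: wp_store => //=.
have hfr' (r : nat) : r \notin [:: 15; 21] -> s r =1 st r.
  by move=> hr' y; rewrite hfr // f1.
rewrite (hpos _ _ hfr' hv); split=> // y hy.
rewrite mkseqS mem_rcons inE orbCA -(h y hy) /upd /=.
by case: (y =P g j).
Qed.

Local Notation address := (address M).

Definition entry_ok (c : circuit) (w : nat) (p : {mpoly rat[k]}) :=
  represents c w p /\ w != 0.

Lemma entry_ok_cat c d w p : entry_ok c w p -> entry_ok (c ++ d) w p.
Proof. by move=> [h1 h2]; split=> //; apply: represents_cat. Qed.

Definition base_ok (st : store) (c : circuit) := forall a r, a < M -> r <= k ->
  entry_ok c (st 20 (address 0 a r)) (D1 (iota a r)).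

Lemma kM : k < M.
Proof. by rewrite /M nE; lia. Qed.

Lemma mvar_denotes c i : i < k ->
  operand_denotes c (Var i) (tofrac (mvar k i)).
Proof.
move=> hi; split=> //=.
rewrite /formal_vars (nth_map (Ordinal hi)) ?size_enum_ord //.
by rewrite (mvarE (Ordinal hi)) (nth_ord_enum _ (Ordinal hi)).
Qed.

Lemma meval_mvar i : i < k -> (mvar k i).@[fun=> 1%R] = 1%R.
Proof. by move=> hi; rewrite (mvarE (Ordinal hi)) mevalXU. Qed.

Lemma wp_base_cell st c a r : a < M -> r <= k ->
  good_state k st c -> st 6 0 = M -> st 12 0 = a -> st 11 0 = r ->
  (0 < a -> forall r', r' <= k ->
     entry_ok c (st 20 (address 0 a.-1 r')) (D1 (iota a.-1 r'))) ->
  (forall r', r' < r -> entry_ok c (st 20 (address 0 a r')) (D1 (iota a r'))) ->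
  wp B base_cell 20 st c (fun st' c' => [/\ good_state k st' c',
     entry_ok c' (st' 20 (address 0 a r)) (D1 (iota a r)) &
     forall y : nat, y != address 0 a r -> st' 20 y = st 20 y]).
Proof.
move=> ha hr hg h6 h12 h11 hprev hcur.
apply: (@wp_weaken _ _ ((2 + (2 + (2 + 1))) + (2 + 1)).+1);
  [|by []|exact: (fun _ _ h => h)].
have fin st1 c1 : (forall r' : nat, r' \notin [:: 3] -> st1 r' =1 st r') ->
    good_state k st1 c1 -> 0 < size c1 ->
    wire_value c1 (size c1).-1 (tofrac (D1 (iota a r))) ->
    (0 < (D1 (iota a r)).@[fun=> 1])%R ->
    wp B (set_cell (Lit 0) 'V 12 'V 11 'V 3) 1 st1 c1 (fun st' c' =>
     [/\ good_state k st' c',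
     entry_ok c' (st' 20 (address 0 a r)) (D1 (iota a r)) &
     forall y : nat, y != address 0 a r -> st' 20 y = st 20 y]).
  move=> f1 [g1 g2] s1 w1 p1; apply: wp_store; rewrite /= g1; first exact: leq_addl.
  rewrite !f1 // h6 h12 h11 -[_ + r]/(address 0 a r); split=> //.
  - rewrite /upd !eqxx; case: (size c1) s1 w1 => // w _ w1; by split.
  - by move=> y hy; rewrite /upd (negbTE hy) andbF f1.
apply: wp_if; rewrite /= h11 h12 => har; last first.
  have e1 : D1 (iota a r) = 1%R.
    rewrite flag_minor_flagged_h_iota; move/eqP: har; rewrite muln_eq0.
    by case/orP=> /eqP ->; rewrite ?expr0 // big_ord0 expr1n.
  apply: wp_seq; apply: (@wp_emit k _ _ _ _ 1%R 1%R _ _ _ hg) => // st1 c1 f1 g1 s1 _ w1.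
  apply: fin => //; first by rewrite s1.
    by rewrite s1 e1 tofrac1; move: w1; rewrite /= mulr1.
  by rewrite e1 meval1 ltr01.
have [a0 r0] : 0 < a /\ 0 < r by move: har; rewrite muln_eq0; lia.
have [A1 A2] := hcur r.-1 (ltac:(lia)).
have [B1 B2] := hprev a0 r hr.
have [E1 E2] := hprev a0 r.-1 (ltac:(lia)).
have hr1 : r.-1 < k by lia.
set dA := D1 _ in A1; set dB := D1 _ in B1; set dE := D1 _ in E1.
have pos w (p : {mpoly rat[k]}) :
    represents c w p -> w != 0 -> (0 < p.@[fun=> 1])%R.
  by case: w => //= w [].
have pA := pos _ _ A1 A2; have pB := pos _ _ B1 B2; have pE := pos _ _ E1 E2.
have pX : (0 < (dA * dB * mvar k r.-1).@[fun=> 1])%R.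
  by rewrite !mevalM meval_mvar // mulr1 mulr_gt0.
have rec : (D1 (iota a r) * dE)%R = (dA * dB * mvar k r.-1)%R.
  rewrite /dA /dB /dE !flag_minor_flagged_h_iota.
  case: (a) a0 => // a' _; case: (r) r0 => // r' _; rewrite /= big_ord_recr /=.
  by rewrite !exprS; ring.
have [q1 q2] := mpoly_div_tofrac rec pE pX.
have fr (st' : store) e : (forall r' : nat, r' \notin [:: 3] -> st' r' =1 st r') ->
    ~~ has (mem [:: 3]) (reads e) -> expr_value st' e = expr_value st e.
  exact: expr_value_frame.
have vE : expr_value st (cell (Lit 0) ('V 12 --e Lit 1) ('V 11 --e Lit 1))
    = st 20 (address 0 a.-1 r.-1) by rewrite /= h6 h11 h12 !subn1.
apply: wp_seq; apply: (wp_emit _ hg).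
- rewrite operand_of_wire /= h6 h11 h12 !subn1.
  by rewrite -[(_ + _)]/(address 0 a r.-1) -subn1; apply: represents_denotes A1 A2.
- rewrite operand_of_wire /= h6 h11 h12 !subn1.
  by rewrite -[(_ + _)]/(address 0 a.-1 r) -subn1; apply: represents_denotes B1 B2.
move=> st1 c1 f1 g1 s1 [d1 e1] w1.
apply: wp_seq; apply: (wp_emit _ g1).
- by rewrite /= (proj1 g1) s1 subn1; exact: wire_denotes w1.
- by rewrite /= f1 // h11 subn1; exact: mvar_denotes.
move=> st2 c2 f2 g2 s2 [d2 e2] w2.
have f2' (r' : nat) : r' \notin [:: 3] -> st2 r' =1 st r' by move=> hr' y; rewrite f2 // f1.
apply: wp_seq; apply: (wp_emit _ g2).
- by rewrite /= (proj1 g2) s2 subn1; exact: wire_denotes w2.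
- rewrite operand_of_wire (fr _ (cell _ _ _) f2') // vE e2 e1 -catA.
  exact: represents_denotes (represents_cat _ E1) E2.
move=> st3 c3 f3 g3 s3 [d3 e3] /=; rewrite -!tofracM q1 => w3.
apply: fin => //; rewrite ?s3 //.
by move=> r' hr' y; rewrite f3 // f2'.
Qed.

Lemma wp_base_table st c : good_state k st c -> env st ->
  wp B base_table (M * (M * 22 + 2 + 2) + 2) st c (fun st' c' =>
    good_state k st' c' /\ base_ok st' c').
Proof.
move=> hg [h0 h1 h2 h4 h6].
pose Inv0 j (st' : store) (c' : circuit) := good_state k st' c' /\
  forall a r, a < j -> r <= k -> entry_ok c' (st' 20 (address 0 a r)) (D1 (iota a r)).
pose Inv1 j i (st' : store) (c' : circuit) := [/\ good_state k st' c',
  forall a r, a < j -> r <= k -> entry_ok c' (st' 20 (address 0 a r)) (D1 (iota a r)) &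
  forall r, r < i -> r <= k -> entry_ok c' (st' 20 (address 0 j r)) (D1 (iota j r))].
apply: (@wp_for _ Inv0 _ _ _ M M _) => //.
- by move=> s hf; rewrite /= hf.
- move=> j s s' c' [[g1 g2] o1] hf; split; first by split=> //; rewrite hf.
  by move=> a r ha hr; rewrite hf //; apply: o1.
move=> j st1 c1 hj f1 v1 _ [g1 o1].
apply: (@wp_weaken _ _ _ _ _ _ (Inv1 j k.+1)); [|exact: leqnn|]; last first.
  move=> st' c' [k1 k2 k3]; split=> // a r; rewrite ltnS leq_eqVlt.
  by case/orP=> [/eqP ->|ha] hr; [apply: k3|apply: k2].
apply: (@wp_for _ (Inv1 j) _ _ _ k.+1 M 20) => //.
- exact: kM.
- exact/ltnW/kM.
- by move=> s hf; rewrite /= hf // f1 // h0 addn1.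
- move=> i s s' c' [[k1 k1'] k2 k3] hf; split; first by split=> //; rewrite hf.
    by move=> a r ha hr; rewrite hf //; apply: k2.
  by move=> r ha hr; rewrite hf //; apply: k3.
move=> i st2 c2 hi f2 v2 _ [g2 o2 n2].
have v12 : st2 12 0 = j by rewrite f2.
have v6 : st2 6 0 = M by rewrite f2 // f1.
have hik : i <= k by lia.
have := @wp_base_cell st2 c2 j i hj hik g2 v6 v12 v2.
case/(_ _ _)/wp_frame.
- by move=> j0 r' hr'; apply: o2 => //; rewrite prednK.
- by move=> r' hr'; apply: n2 => //; lia.
move=> st4 [c4 [m4 [r4 hl [[g4 cell4 e4] _ [d e]]]]].
have kM := kM.
have iM : i < M by lia.
exists st4, c4, m4; split=> //; split=> // [a r ha hr|r].
  have [aM rM] : a < M /\ r < M by lia.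
  rewrite e4 ?e; first exact/entry_ok_cat/o2.
  by rewrite (address_neq aM rM hj iM) // (ltn_eqF ha).
rewrite ltnS leq_eqVlt => /orP[/eqP -> //|hri hrk].
have rM : r < M by lia.
rewrite e4 ?e; first exact/entry_ok_cat/n2.
by rewrite (address_neq hj rM hj iM) // (ltn_eqF hri) orbT.
Qed.

Let dcost := M * (M * (M * 22 + 2 + 2) + 2 + 2) + 2.

Definition skew_ok (c : circuit) (w : nat) (cs : seq nat) :=
  represents c w (D2 cs) /\ (nz2 cs -> w != 0).

Lemma skew_ok_cat c d w cs : skew_ok c w cs -> skew_ok (c ++ d) w cs.
Proof. by move=> [h1 h2]; split=> //; apply: represents_cat. Qed.

(** The exponents are mu_q + k - 1 - q with mu_q = lam_q + a - lam_0, the parts left after removal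
    of the rectangle; the hypothesis says that mu_q >= 0. *)
Lemma sorted_straight a r : r <= k -> (forall q, q < r -> lam_ 0 <= lam_ q + a) ->
  sorted ltn (iota 0 (k - r) ++ mkseq (fun q => k.-1 + a - l (r.-1 - q)) r).
Proof.
move=> hr hq; apply/(sortedP 0) => i; rewrite size_cat size_iota size_mkseq => hi.
rewrite !nth_cat size_iota; case: (ltnP i.+1 (k - r)) => h1.
  by rewrite (ltnW h1) !nth_iota ?(ltnW h1) //= add0n.
case: (ltnP i (k - r)) => h2.
  rewrite nth_iota // nth_mkseq; last by lia.
  have hq1 := hq (r.-1 - (i.+1 - (k - r))) (ltac:(lia)).
  rewrite /= /l add0n; have := lam_anti (leq0n (r.-1 - (i.+1 - (k - r)))); lia.
rewrite !nth_mkseq; [|lia|lia].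
set p := r.-1 - _; set q := r.-1 - _.
have epq : p = q.+1 by rewrite /p /q; lia.
have := lam_anti (leqnSn q); have := lam_anti (leq0n q); have := lam_anti (leq0n q.+1).
have := hq q.+1 (ltac:(rewrite -epq /p; lia)).
by rewrite /= /l epq; lia.
Qed.

Lemma wp_skew_cell st c a r : a <= n -> r <= k ->
  good_state k st c -> env st -> st 5 0 = 2 * n ->
  st 13 0 = r -> st 14 0 = a -> base_ok st c ->
  wp B skew_cell (2 * (M * 3 + 2) + (dcost + 1) + 1).+1 st c (fun st' c' =>
    [/\ good_state k st' c', base_ok st' c',
     skew_ok c' (st' 22 (a * M + r)) (iota a r) &
     forall y : nat, y != a * M + r -> st' 22 y = st 22 y]).
Proof.
move=> ha hr hg henv h5 h13 h14 hb.
have [e0 e1 e2 e4 e6] := henv.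
have kn : k <= n by rewrite nE; lia.
have M2 : 2 * n < M by rewrite /M; lia.
have lam0n : lam_ 0 <= n by rewrite nE; lia.
apply: wp_if; rewrite /= !e1 h13 h14 (subn1 r) => hguard; last first.
  apply: wp_store => //=; rewrite h14 h13 e6.
  have hnz : ~~ nz2 (iota a r).
    apply/nz2P => /(_ r.-1); rewrite size_iota /l => /(_ (ltac:(lia))).
    by rewrite nth_iota; lia.
  split; [by case: hg | by [] | split | by move=> y hy; rewrite /upd (negbTE hy) andbF].
    by rewrite /upd !eqxx; apply: nz2_eq0 => //; apply: iota_ltn_sorted.
  by move=> h; rewrite h in hnz.
have hq q : q < r -> lam_ 0 <= lam_ q + a.
  by move=> hqr; have := @lam_anti q r.-1 (ltac:(lia)); lia.
pose L := iota 0 (k - r) ++ mkseq (fun q => k.-1 + a - l (r.-1 - q)) r.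
have sL : size L = k by rewrite size_cat size_iota size_mkseq subnK.
have DL : D2 (iota a r) = D1 L.
  apply: flag_minor_skew_h_iota => // q hqr; have := hq q hqr.
  by have := lam_anti (leq0n q); rewrite /l; lia.
(* Truncated subtraction makes [f y] nonzero exactly for y < k - r; [g p] is the exponent k - 1 + a
   - l_p with all subtractions collected into one. *)
pose f y := k - r - y; pose g p := k + a + lam_ p - (lam_ 0 + p + 1).
have mL y : (y \in L) = (y < 2 * n) && ((f y != 0) || (y \in mkseq g r)).
  rewrite mem_cat mem_iota leq0n add0n /=.
  have -> : (y \in mkseq (fun q => k.-1 + a - l (r.-1 - q)) r) = (y \in mkseq g r).
    apply/mapP/mapP => -[q]; rewrite mem_iota => /= hqr ->;
      exists (r.-1 - q); rewrite ?mem_iota; try lia; rewrite /g /l.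
    - by have := hq (r.-1 - q) (ltac:(lia)); have := lam_anti (leq0n (r.-1 - q)); lia.
    - have -> : r.-1 - (r.-1 - q) = q by lia.
      by have := hq q hqr; have := lam_anti (leq0n q); lia.
  have -> : (y < k - r) = (f y != 0) by rewrite /f; lia.
  case hfy: (f y != 0) => /=; first by rewrite andbT; move: hfy; rewrite /f; lia.
  case hm: (y \in mkseq g r); rewrite ?andbF // andbT.
  move/mapP: hm => [q]; rewrite mem_iota => /= hqr ->; rewrite /g.
  by have := lam_anti (leq0n q); have := k_gt0; lia.
apply: wp_seq; have wm : wp B (mark ('V 0 --e 'V 13 --e 'V 15) 'V 13
     ('V 0 ++e 'V 14 ++e Read 1 'V 15 --e (Read 1 (Lit 0) ++e 'V 15 ++e Lit 1)))
     (2 * (M * 3 + 2)) st c (fun st' c' => good_state k st' c' /\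
     forall y, y < 2 * n -> (st' 21 y != 0) = (f y != 0) || (y \in mkseq g r)).
  apply: wp_mark => //.
  - exact: ltnW.
  - by apply: ltnW; apply: leq_ltn_trans hr kM.
  - by move=> st' j hf hj; rewrite /= hj !hf // e0 h13.
  - by move=> j; rewrite /f /B; have := kM; lia.
  - by move=> st' hf; rewrite /= hf.
  - by move=> st' j hf hj; rewrite /= hj !hf // e0 h14 !e1.
apply: (wp_weaken (wp_frame wm)); [exact: leqnn|].
move=> st1 c1 [[g1 k1] f1 [d1 ed1]].
pose keep y := st1 21 y != 0.
have kL : filter keep (iota 0 (2 * n)) = L.
  apply: filter_iota_eq; first exact: sorted_straight.
  by move=> y; rewrite mL; case: ltnP => //= hy; rewrite /keep k1.
have hdel : wp B delete_columns dcost st1 c1 (fun st' c' =>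
    [/\ good_state k st' c',
      cell_ok (flagged_h (mvar k)) nz1 keep (2 * n) M st' c' (2 * n) 0 k &
      base_kept M st1 st']).
  have kM := kM.
  apply: wp_delete_columns => //.
  - by apply: ltnW; apply: ltn_trans M2 _.
  - by apply: ltn_trans kM _.
  - exact: ltnW.
  - by rewrite f1.
  - by rewrite f1.
  - by rewrite f1.
  move=> a' r' ha' hr'; rewrite /cell_ok f1 //.
  have -> : interval keep (2 * n) 0 a' r' = iota a' r' by rewrite /interval /= map_id.
  have [|b1 b2] := hb a' r' _ hr'; first exact: leq_ltn_trans ha' M2.
  by split=> //; rewrite ed1; apply: represents_cat.
apply: wp_seq; apply: (wp_weaken (wp_frame hdel)); [exact: leqnn|].
move=> st2 c2 [[g2 [r2 n2] b2] f2 [d2 ed2]].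
rewrite -[X in interval _ _ _ _ X]sL interval_kept // in r2 n2.
have v5 : st2 5 0 = 2 * n by rewrite f2 // f1.
have v6 : st2 6 0 = M by rewrite f2 // f1.
have v0 : st2 0 0 = k by rewrite f2 // f1.
have v13 : st2 13 0 = r by rewrite f2 // f1.
have v14 : st2 14 0 = a by rewrite f2 // f1.
have eaddr : 2 * n * M * M + k = address (2 * n) 0 k by rewrite /address addn0.
apply: wp_store; rewrite /= v0 v5 v6 ?v13 ?v14 ?addn0 eaddr.
  exact: leq_trans (represents_leq r2) (leq_addl _ _).
split.
- by case: g2.
- move=> a' r' ha' hr'; rewrite -[upd _ _ _ _ 20 _]/(st2 20 _) b2; last first.
    by rewrite /address; have := kM; nia.
  have [k1' k2'] := hb a' r' ha' hr'.
  rewrite f1 // ed2 ed1 -catA; split=> //; exact: represents_cat.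
- split; first by rewrite /upd !eqxx /= DL.
  by move=> _; rewrite /upd !eqxx /=; apply: n2.
- by move=> y hy; rewrite /upd (negbTE hy) andbF f2 // f1.
Qed.

Definition table_ok (t : nat) (st : store) (c : circuit) := forall a r,
  a <= n -> r <= k -> skew_ok c (st t (a * M + r)) (iota a r).

Lemma aM a : a <= n -> a < M.
Proof. by rewrite /M; lia. Qed.

(** Shared by the two double loops over intervals, with [t] the array they fill. In array 20 the
    index a M + r is the address of the cell with s = 0. *)
Lemma wp_grid (t : nat) (body : cmd) (m : nat) (K : store -> circuit -> Prop) st c :
  t != 13 -> t != 14 -> ~~ has (mem (writes body)) [:: 0; 4; 13; 14] ->
  (forall (s s' : store) c', (forall r : nat, r \notin [:: 13; 14] -> s' r =1 s r) ->
     K s c' -> K s' c') ->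
  (forall (st' : store) c' a r, a <= n -> r <= k ->
     (forall r : nat, r \notin 13 :: 14 :: writes body -> st' r =1 st r) ->
     st' 13 0 = r -> st' 14 0 = a -> K st' c' ->
     wp B body m st' c' (fun st'' c'' => [/\ K st'' c'',
       skew_ok c'' (st'' t (a * M + r)) (iota a r) &
       forall y, y != a * M + r -> st'' t y = st' t y])) ->
  env st -> K st c ->
  wp B (For 13 ('V 0 ++e Lit 1) (For 14 ('V 4 ++e Lit 1) body))
    (M * (M * (m + 2) + 2 + 2) + 2) st c
    (fun st' c' => K st' c' /\ table_ok t st' c').
Proof.
move=> t13 t14 + hK hbody [e0 _ _ e4 _] hKst.
rewrite /= !negb_or => /and5P[w0 w4 w13 w14 _].
have w' r : r \notin writes body -> r != 13 -> r != 14 ->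
    r \notin writes (For 14 ('V 4 ++e Lit 1) body).
  by move=> hr h13 h14; rewrite /= !(mem_cat, inE) !negb_or h14 hr.
pose Inv0 j (st' : store) (c' : circuit) := K st' c' /\
  forall a r, a <= n -> r <= k -> r < j -> skew_ok c' (st' t (a * M + r)) (iota a r).
pose Inv1 j i (st' : store) (c' : circuit) := Inv0 j st' c' /\
  forall a, a <= n -> a < i -> skew_ok c' (st' t (a * M + j)) (iota a j).
have Inv0_frame j (s s' : store) c' : Inv0 j s c' ->
    (forall r : nat, r \notin [:: 13; 14] -> s' r =1 s r) -> Inv0 j s' c'.
  move=> [k1 k2] hf; split; first exact: hK k1.
  by move=> a r ha hr hj; rewrite hf ?inE ?negb_or ?t13 //; apply: k2.
apply: (@wp_weaken _ _ _ _ _ _ (Inv0 k.+1)); [|exact: leqnn|]; last first.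
  by move=> st' c' [k1 k2]; split=> // a r ha hr; apply: k2.
apply: (@wp_for _ Inv0 _ _ _ k.+1 M _) => //.
- exact: kM.
- exact/ltnW/kM.
- by rewrite /= !(mem_cat, inE) /= orbF.
- move=> s hf; rewrite /= hf ?e0 ?addn1 // inE negb_or /=.
  exact: w'.
- move=> j s s' c' hi hf; apply: Inv0_frame hi _ => r.
  by rewrite !inE negb_or => /andP[hr _]; apply: hf.
move=> j st1 c1 hj f1 v1 _ i1.
apply: (@wp_weaken _ _ _ _ _ _ (Inv1 j n.+1)); [|exact: leqnn|]; last first.
  move=> st' c' [[k1 k2] k3]; split=> // a r ha hr; rewrite ltnS leq_eqVlt.
  by case/orP=> [/eqP ->|hrj]; [apply: k3|apply: k2].
apply: (@wp_for _ (Inv1 j) _ _ _ n.+1 M _) => //.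
- exact: aM.
- exact/ltnW/aM.
- move=> s hf; rewrite /= hf ?inE ?negb_or //= f1 ?e4 ?addn1 // inE negb_or /=.
  exact: w'.
- move=> i s s' c' [hi k4] hf; split.
    by apply: Inv0_frame hi _ => r; rewrite !inE negb_or => /andP[_ hr]; apply: hf.
  by move=> a ha hai; rewrite hf //; apply: k4.
move=> i st2 c2 hi f2 v2 _ [[K2 o2] n2].
have hik : i <= n by lia.
have hjk : j <= k by lia.
have v13 : st2 13 0 = j by rewrite f2 // inE negb_or.
have f2' (r : nat) : r \notin 13 :: 14 :: writes body -> st2 r =1 st r.
  rewrite !inE !negb_or => /and3P[h13 h14 hr] y.
  have hr' := w' r hr h13 h14.
  by rewrite f2 ?f1 // inE negb_or ?h13 ?h14.
have := wp_frame (hbody _ _ _ _ hik hjk f2' v13 v2 K2).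
case=> st3 [c3 [m3 [r3 hm3 [[K3 s3 o3] _ [d ed]]]]].
exists st3, c3, m3; split=> //.
have jM := leq_ltn_trans hjk kM; have iM := aM hik.
split; first split=> //.
  move=> a r ha hr hrj; have rM := leq_ltn_trans hr kM; rewrite o3 ?ed.
    exact/skew_ok_cat/o2.
  by apply: (@address_neq M 0 a r 0 i j (aM ha)); rewrite // (ltn_eqF hrj) !orbT.
move=> a ha; rewrite ltnS leq_eqVlt => /orP[/eqP ->|hai]; first by [].
rewrite o3 ?ed; first exact/skew_ok_cat/n2.
by apply: (@address_neq M 0 a j 0 i j (aM ha)); rewrite // (ltn_eqF hai) !orbT.
Qed.

Lemma wp_skew_table st c : good_state k st c -> env st -> st 5 0 = 2 * n ->
  base_ok st c ->
  wp B skew_table (M * (M * ((2 * (M * 3 + 2) + (dcost + 1) + 1).+1 + 2) + 2 + 2) + 2)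
    st c (fun st' c' => good_state k st' c' /\ table_ok 22 st' c').
Proof.
move=> hg henv h5 hb.
pose K st' c' := good_state k st' c' /\ base_ok st' c'.
apply: (@wp_weaken _ _ _ _ _ _ (fun st' c' => K st' c' /\ table_ok 22 st' c'));
  [apply: wp_grid => //|exact: leqnn|by move=> st' c' [[]]].
  move=> s s' c' hf [[k1 k1'] k2]; split; first by split=> //; rewrite hf.
  by move=> a r ha hr; rewrite hf //; apply: k2.
move=> st' c' a r ha hr hf v13 v14 [g' b'].
have env' : env st' by apply: env_frame hf _ henv.
have v5 : st' 5 0 = 2 * n by rewrite hf.
apply: wp_weaken (wp_skew_cell ha hr g' env' v5 v13 v14 b') (leqnn _) _.
by move=> s2 c2 [].
Qed.

Lemma wp_load_table st c : good_state k st c -> env st -> table_ok 22 st c ->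
  wp B load_table (M * (M * (1 + 2) + 2 + 2) + 2) st c (fun st' c' =>
    good_state k st' c' /\ table_ok 20 st' c').
Proof.
move=> hg henv ht; have [_ _ _ _ e6] := henv.
pose K st' c' := good_state k st' c' /\ table_ok 22 st' c'.
apply: (@wp_weaken _ _ _ _ _ _ (fun st' c' => K st' c' /\ table_ok 20 st' c'));
  [apply: wp_grid => //|exact: leqnn|by move=> st' c' [[]]].
  move=> s s' c' hf [[k1 k1'] k2]; split; first by split=> //; rewrite hf.
  by move=> a r ha hr; rewrite hf //; apply: k2.
move=> st' c' a r ha hr hf v13 v14 [g' t'].
have v6 : st' 6 0 = M by rewrite hf.
have w := t' a r ha hr; apply: wp_store; rewrite /= v6 v13 v14.
  exact: leq_trans (represents_leq (proj1 w)) (leq_addl _ _).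
split; [by split; first by case: g'|by rewrite /upd !eqxx; apply: w|].
by move=> y hy; rewrite /upd (negbTE hy) andbF.
Qed.

(** The dominant term is [dcost], of order M^3, multiplied by M * M for the intervals of the skew
    table. *)
Definition program_steps :=
  1 + (1 + (1 + ((M * (M * 22 + 2 + 2) + 2) +
   ((M * (M * ((2 * (M * 3 + 2) + (dcost + 1) + 1).+1 + 2) + 2 + 2) + 2) +
   (1 + ((M * (M * (1 + 2) + 2 + 2) + 2) + (2 * (M * 3 + 2) + (dcost + 2)))))))).

Lemma wp_program :
  wp B skew_schur_program program_steps (input_store lam nu) [::] (fun _ c =>
    [/\ wf_from k 0 c, 0 < size c &
     wire_value c (size c).-1 (tofrac (skew_schur lam nu))]).
Proof.
have kM := kM; have nM := aM (leqnn n); have n_lt_B : n < B by rewrite ltnS ltnW.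
apply: wp_seq; apply: wp_store; rewrite /= -/(lam_ 0) -nE ?addn0; first exact: ltnW.
apply: wp_seq; apply: wp_store => /=; rewrite /upd /= -/M ?addn0; first by [].
apply: wp_seq; apply: wp_store => /=; rewrite /upd /= ?addn0.
  by rewrite /B /M; lia.
set st := (fun r' : nat => _).
have env0 : env st by split.
have good0 : good_state k st [::] by split.
have h5 : st 5 0 = 2 * n by [].
move: st env0 good0 h5 => st env0 good0 h5.
apply: wp_seq; apply: (wp_weaken (wp_frame (wp_base_table good0 env0))); [exact: leqnn|].
move=> st1 c1 [[g1 b1] f1 _].
have env1 : env st1 by apply: env_frame f1 _ env0.
have h5' : st1 5 0 = 2 * n by rewrite f1.
apply: wp_seq; apply: (wp_weaken (wp_frame (wp_skew_table g1 env1 h5' b1))); [exact: leqnn|].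
move=> st2 c2 [[g2 t2] f2 _].
have env2 : env st2 by apply: env_frame f2 _ env1.
have [k0 k1 k2 k4 k6] := env2.
apply: wp_seq; apply: wp_store => /=; rewrite k4.
  by apply: leq_trans (leq_addr _ _); apply: ltnW.
set st3 := upd _ _ _ _.
have g3 : good_state k st3 c2 by [].
have env3 : env st3 by [].
have t3 : table_ok 22 st3 c2 by [].
have h53 : st3 5 0 = n by [].
move: st3 g3 env3 t3 h53 => st3 g3 env3 t3 h53.
apply: wp_seq; apply: (wp_weaken (wp_frame (wp_load_table g3 env3 t3))); [exact: leqnn|].
move=> st4 c4 [[g4 t4] f4 _].
have [e0 e1 e2 e4 e6] : env st4 by apply: env_frame f4 _ env3.
have h54 : st4 5 0 = n by rewrite f4.
pose g j := lam_ 0 - nu_ j + j.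
apply: wp_seq; have wm : wp B
    (mark (Lit 0) 'V 0 (Read 1 (Lit 0) --e Read 2 'V 15 ++e 'V 15))
    (2 * (M * 3 + 2)) st4 c4 (fun st' c' => good_state k st' c' /\
    forall y, y < n -> (st' 21 y != 0) = ((fun=> 0) y != 0) || (y \in mkseq g k)).
  apply: wp_mark => //; try exact: ltnW.
  - by move=> st' hf; rewrite /= hf.
  - by move=> st' j hf hj; rewrite /= hj !hf // e1 e2.
apply: (wp_weaken (wp_frame wm)); [exact: leqnn|].
move=> st5 c5 [[g5 m5] f5 [d5 ed5]].
pose keep y := st5 21 y != 0.
have g_lt j : j < k -> g j < n.
  by move=> hj; rewrite /g nE; lia.
have kL : filter keep (iota 0 n) = mkseq g k.
  apply: filter_iota_eq.
    apply/(sortedP 0) => i; rewrite size_mkseq => hi.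
    rewrite !nth_mkseq //; last exact: ltnW.
    by have := nu_anti (leqnSn i); rewrite /g /=; lia.
  move=> y; case: (ltnP y n) => /= hy; first by rewrite /keep m5.
  apply/negbTE/negP => /mapP[j]; rewrite mem_iota => /= /g_lt hj ej.
  by rewrite ej leqNgt hj in hy.
have hdel : wp B delete_columns dcost st5 c5 (fun st' c' =>
    [/\ good_state k st' c',
      cell_ok (skew_h (mvar k) k l) nz2 keep n M st' c' n 0 k &
      base_kept M st5 st']).
  apply: (wp_delete_columns nz2_eq0 nz2_mono) => //; try exact: ltnW.
  - by rewrite f5.
  - by rewrite f5.
  - by rewrite f5.
  move=> a r ha hr; rewrite /cell_ok f5 //.
  have -> : interval keep n 0 a r = iota a r by rewrite /interval /= map_id.
  by have [b1' b2'] := t4 a r ha hr; split=> //; rewrite ed5; apply: represents_cat.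
apply: wp_seq; apply: (wp_weaken (wp_frame hdel)); [exact: leqnn|].
move=> st6 c6 [[g6 [r6 n6] _] f6 _].
rewrite -[X in interval _ _ _ _ X](size_mkseq g k) interval_kept // in r6 n6.
have schurE : D2 (mkseq g k) = skew_schur lam nu.
  rewrite (@skew_schur_flag_minor _ lam nu (lam_ 0)) //.
    by move=> i _; apply: lam_anti.
  by move=> i _; apply: leq_trans (nu_le_lam i) _; apply: lam_anti.
(* Containment of nu in lam is precisely the criterion [nz2] for these columns. *)
have w0 : st6 20 (address n 0 k) != 0.
  apply: n6; apply/nz2P => q; rewrite size_mkseq => hq; rewrite nth_mkseq // /l /g.
  by have := nu_le_lam q; lia.
rewrite schurE in r6.
apply: (wp_emit _ g6).
- have v5 : st6 5 0 = n by rewrite f6 // f5.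
  have v6 : st6 6 0 = M by rewrite f6 // f5.
  have v0 : st6 0 0 = k by rewrite f6 // f5.
  rewrite operand_of_wire /= v5 v6 v0.
  rewrite -[X in Wire (st6 20 X - 1)]/(address n 0 k).
  exact: represents_denotes r6 w0.
- by split=> //; rewrite /= mulr1n.
move=> st7 c7 f7 [_ g7] s7 _; rewrite /= mulr1 => w7.
by split=> //; rewrite s7.
Qed.

End SkewTable.

(** * Size and bit complexity *)

Lemma program_steps_le : exists K, forall (k : nat) (lam : k.-tuple nat),
  0 < problem_size lam -> program_steps lam <= K * problem_size lam ^ 5.
Proof.
(* With M = 2n+1 <= 3n, the factor 243 is 3^5, and 150 exceeds the sum of the coefficients of the
   step count as a polynomial of degree 5 in M. *)
exists (150 * 243) => k lam n0; rewrite -mulnA -[243]/(3 ^ 5) -expnMn.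
have : 2 * problem_size lam + 1 <= 3 * problem_size lam by lia.
rewrite -(leq_exp2r _ _ (isT : 0 < 5)) => h; apply: leq_trans (leq_mul (leqnn 150) h).
rewrite /program_steps !addn1; move: (2 * _).+1 (ltn0Sn (2 * problem_size lam)) => M M0.
have h2 : M <= M * M by nia.
have h3 : M * M <= M * M * M by nia.
have h4 : M * M * M <= M * M * M * M by nia.
have h5 : M * M * M * M <= M * M * M * M * M by nia.
by rewrite !expnS expn0; lia.
Qed.

Lemma bounded_input_store (k : nat) (lam nu : k.-tuple nat) V :
  skew_shape lam nu -> problem_size lam <= V -> bounded V (input_store lam nu).
Proof.
move=> shape hV; have := nE lam => en r a.
have h0 : nth 0 lam a <= nth 0 lam 0 by exact: (lam_anti shape).
have h1 : nth 0 nu a <= nth 0 lam a by exact: (nu_le_lam shape).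
by case: r => [|[|[|r]]] //=; first case: ifP => _; lia.
Qed.

Lemma exec_program : exists K, forall (k : nat) (lam nu : k.-tuple nat),
  skew_shape lam nu -> exists c t, let V := 2 * problem_size lam + 2 + size c in
    let W := (cmd_weight skew_schur_program).+1 in
  [/\ generates skew_schur_program lam nu c t, computes c (skew_schur lam nu),
      size c <= K * problem_size lam ^ 5,
      t <= K * problem_size lam ^ 5 * (4 * ((W + 1) * bitlen V) ^ 2)
    & all (gate_fits (W * bitlen V)) c].
Proof.
have [K hK] := program_steps_le; exists K => k lam nu shape.
set n := problem_size lam; have n0 : 0 < n by rewrite /n nE; have := k_gt0 shape; lia.
have [s [c [m [r hm [wf c0 [_ hc]]]]]] := wp_program shape.
have {}hm := leq_trans hm (hK _ _ n0).
have [d ed hd] := run_cat r; rewrite cat0s in ed; rewrite -ed in hd.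
set V := (2 * n + 1).+1 + size c.
have hb : bounded V (input_store lam nu).
  by apply: bounded_input_store => //; rewrite -/n /V; lia.
have [d' [t [ed' ex ht _ hg]]] := run_exec r (leqnn V) hb (leqnSn _).
rewrite cat0s in ed'; rewrite -ed' in ex hg.
have eV : 2 * n + 2 + size c = V by rewrite /V; lia.
exists c, t; rewrite /= eV; split=> //.
- by exists s.
- split; first by rewrite /wf_circuit c0.
  by rewrite /circuit_output -nth_last size_circuit_values.
- exact: leq_trans hd hm.
- by apply: leq_trans ht _; rewrite leq_mul2r hm orbT.
Qed.

(** For n > 1 the logarithm is at least 1, hence absorbs constants and gives bitlen n <= 2 log n;
    [bitlenX] contributes the factor 6 in 12 = 6 * 2. *)
Lemma bitlen_size_le n V C : 1 < n -> V <= C * n ^ 5 ->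
  bitlen V <= (bitlen C + 12) * trunc_log 2 n.
Proof.
move=> n1 hV; have T0 : 0 < trunc_log 2 n by rewrite trunc_log_gt0.
apply: leq_trans (leq_bitlen hV) _; apply: leq_trans (bitlenM _ _) _.
have : bitlen n <= 2 * trunc_log 2 n by rewrite /bitlen; lia.
have := bitlenX n 5; have := leq_pmulr (bitlen C) T0.
by rewrite mulnDl; lia.
Qed.

Theorem theorem2p5 :
  exists P : cmd,
    (exists C : nat,
      forall (k : nat) (lam nu : k.-tuple nat), skew_shape lam nu ->
        exists (c : circuit) (t : nat),
          [/\ generates P lam nu c t,
              computes c (skew_schur lam nu)
            & size c <= C * problem_size lam ^ 5])
    /\
    (forall d : nat, exists C : nat,
      forall (k : nat) (lam nu : k.-tuple nat), skew_shape lam nu ->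
      forall (c : circuit) (t : nat), generates P lam nu c t ->
        let n := problem_size lam in
        1 < n ->
        t + perform_cost (d * trunc_log 2 n) c
          <= C * (n ^ 5 * trunc_log 2 n ^ 2)).
Proof.
have [K hK] := exec_program; exists skew_schur_program; split.
  exists K => k lam nu shape.
  by have [c [t [h1 h2 h3 _ _]]] := hK _ _ _ shape; exists c, t.
move=> d; pose W := (cmd_weight skew_schur_program).+1.
(* The largest stored number is at most 2n + 2 + K n^5 <= (K + 4) n^5. *)
pose C2 := bitlen (K + 4) + 12.
(* The first square pays for generating the gates, the second for performing them. *)
exists (K * (4 * ((W + 1) * C2) ^ 2 + 5 * (W * C2 + d) ^ 2)).
move=> k lam nu shape c t [s hs] n n1.
have [c' [t' []]] := hK _ _ _ shape; rewrite -/n -/W.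
move=> [s' hs'] _ hc ht hg.
have [_ ec et] := exec_det hs hs'; subst c' t'.
set T := trunc_log 2 n; set V := 2 * n + 2 + size c in ht hg.
have hL : bitlen V <= C2 * T.
  apply: bitlen_size_le => //; rewrite mulnDl /V.
  have : n <= n ^ 5 by rewrite -[X in X <= _]expn1 leq_pexp2l // ltnW.
  by lia.
have hX : 0 < W * bitlen V by [].
have hp := leq_trans (perform_cost_le (d * T) hX hg) (leq_mul hc (leqnn _)).
apply: leq_trans (leq_add ht hp) _.
have h1 : 4 * ((W + 1) * bitlen V) ^ 2 <= 4 * ((W + 1) * C2) ^ 2 * T ^ 2.
  by rewrite -mulnA -expnMn leq_mul2l /= leq_exp2r // -mulnA leq_mul2l hL orbT.
have h2 : 5 * (W * bitlen V + d * T) ^ 2 <= 5 * (W * C2 + d) ^ 2 * T ^ 2.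
  rewrite -mulnA -expnMn leq_mul2l /= leq_exp2r // mulnDl leq_add2r -mulnA.
  by rewrite leq_mul2l hL orbT.
by rewrite -mulnDr mulnACA [in X in _ <= X]mulnDl leq_mul // leq_add.
Qed.
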